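(* Let $S_0,S_1,\dots$ enumerate the $\Sigma^0_1$-sentences and let $J_0,J_1,\dots$ be an effective enumeration of ${\sf S}^1_2$-cuts with ${\sf S}^1_2\vdash J_{n+1}\subseteq J_n$ for all $n$ and such that for every ${\sf S}^1_2$-cut $J$ there is $k$ with ${\sf S}^1_2\vdash J_k\subseteq J$. Let $I_0:=J_0$ and, given $I_n$, let ${\sf m}(n)$ be the maximum of $\rho({\sf S}^1_2)$, $\rho({\sf prov}_{{\sf S}^1_2}(x))+\rho(I_n)+1$ and $\rho(S_0),\dots,\rho(S_n)$, and let $I_{n+1}$ be an ${\sf S}^1_2$-cut with ${\sf S}^1_2\vdash I_{n+1}\subseteq J_{n+1}$ which is $\Sigma^0_1$-sound for every consistent recursively enumerable extension of ${\sf S}^1_2$ of complexity at most ${\sf m}(n)$ (i.e. if such an extension proves $S^{I_{n+1}}$ for a $\Sigma^0_1$-sentence $S$, then $S$ is true). Let ${\sf U}:={\sf S}^1_2+\{S_i^{I_i}\to S_i^{J_j}\mid i,j\in\omega\}$. Then there is no ${\sf S}^1_2$-cut $I^\ast$ such that ${\sf U}\vdash S^{I^\ast}\to S^J$ for all $\Sigma^0_1$-sentences $S$ and all ${\sf S}^1_2$-cuts $J$.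
   Context: ${\sf S}^1_2$ is Buss's bounded arithmetic. An ${\sf S}^1_2$-cut is a formula $I(x)$ that ${\sf S}^1_2$ proves defines a set containing $0$, closed under successor and downward closed; $S^I$ is $S$ relativised to $I$; ${\sf S}^1_2\vdash I\subseteq J$ means ${\sf S}^1_2\vdash\forall x(I(x)\to J(x))$. $\rho$ is depth of quantifier alternations; $\rho$ of a finitely axiomatised theory is the maximum over its axioms; an extension of ${\sf S}^1_2$ has complexity at most $m$ if it is axiomatised by ${\sf S}^1_2$ plus sentences of $\rho$-complexity $\leq m$. ${\sf prov}_{{\sf S}^1_2}(x)$ is a standard arithmetised provability predicate for ${\sf S}^1_2$. *)

(* Defs.v *)
From Stdlib Require List.
From mathcomp Require Import all_boot.

Set Implicit Arguments.
Unset Strict Implicit.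
Unset Printing Implicit Defensive.

(* First-order formulas over Buss's language of bounded arithmetic, with de   *)
(* Bruijn indices: [Var 0] is the variable bound by the innermost quantifier. *)

Inductive term :=
  | Var of nat
  | Zero
  | Succ of term
  | Add of term & term
  | Mul of term & term
  | Half of term                (* |_ t / 2 _| *)
  | Len of term                 (* | t |, the length of t in binary *)
  | Smash of term & term.       (* t # u = 2 ^ (|t| * |u|) *)

Inductive form :=
  | Bot
  | Eq of term & term
  | Le of term & term
  | Imp of form & form
  | And of form & form
  | Or of form & form
  | All of form
  | Ex of form.

Definition Not (A : form) : form := Imp A Bot.
Definition Iff (A B : form) : form := And (Imp A B) (Imp B A).

Fixpoint tsubst (s : nat -> term) (t : term) : term :=
  match t with
  | Var n => s n
  | Zero => Zero
  | Succ t => Succ (tsubst s t)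
  | Add t u => Add (tsubst s t) (tsubst s u)
  | Mul t u => Mul (tsubst s t) (tsubst s u)
  | Half t => Half (tsubst s t)
  | Len t => Len (tsubst s t)
  | Smash t u => Smash (tsubst s t) (tsubst s u)
  end.

Definition tshift : term -> term := tsubst (fun n => Var n.+1).

Definition scons (t : term) (s : nat -> term) (n : nat) : term :=
  if n is n'.+1 then s n' else t.

Definition up (s : nat -> term) : nat -> term :=
  scons (Var 0) (fun n => tshift (s n)).

Fixpoint fsubst (s : nat -> term) (A : form) : form :=
  match A with
  | Bot => Bot
  | Eq t u => Eq (tsubst s t) (tsubst s u)
  | Le t u => Le (tsubst s t) (tsubst s u)
  | Imp A B => Imp (fsubst s A) (fsubst s B)
  | And A B => And (fsubst s A) (fsubst s B)
  | Or A B => Or (fsubst s A) (fsubst s B)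
  | All A => All (fsubst (up s) A)
  | Ex A => Ex (fsubst (up s) A)
  end.

Definition fshift : form -> form := fsubst (fun n => Var n.+1).

(* Instantiates [Var 0] by [t] and lowers all other indices. *)
Definition inst (t : term) : form -> form := fsubst (scons t Var).

(* Replaces [Var 0] by [t] without lowering the other indices. *)
Definition repl (t : term) : form -> form :=
  fsubst (scons t (fun n => Var n.+1)).

(* The least n such that all free variables have index < n. *)
Fixpoint tfv (t : term) : nat :=
  match t with
  | Var n => n.+1
  | Zero => 0
  | Succ t | Half t | Len t => tfv t
  | Add t u | Mul t u | Smash t u => maxn (tfv t) (tfv u)
  end.

Fixpoint fv (A : form) : nat :=
  match A with
  | Bot => 0
  | Eq t u | Le t u => maxn (tfv t) (tfv u)
  | Imp A B | And A B | Or A B => maxn (fv A) (fv B)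
  | All A | Ex A => (fv A).-1
  end.

Definition sentence (A : form) : Prop := fv A = 0.

Definition univ_closure (A : form) : form := iter (fv A) All A.

(* Classical natural deduction with equality.  All theories below consist of  *)
(* sentences, so that [nd_ax] needs no side condition.                        *)

Definition theory := form -> Prop.

Inductive nd (T : theory) : seq form -> form -> Prop :=
  | nd_ax G A : T A -> nd T G A
  | nd_hyp G A : List.In A G -> nd T G A
  | nd_raa G A : nd T (Not A :: G) Bot -> nd T G A
  | nd_impI G A B : nd T (A :: G) B -> nd T G (Imp A B)
  | nd_impE G A B : nd T G (Imp A B) -> nd T G A -> nd T G B
  | nd_andI G A B : nd T G A -> nd T G B -> nd T G (And A B)
  | nd_andEl G A B : nd T G (And A B) -> nd T G A
  | nd_andEr G A B : nd T G (And A B) -> nd T G B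
  | nd_orIl G A B : nd T G A -> nd T G (Or A B)
  | nd_orIr G A B : nd T G B -> nd T G (Or A B)
  | nd_orE G A B C :
      nd T G (Or A B) -> nd T (A :: G) C -> nd T (B :: G) C -> nd T G C
  | nd_allI G A : nd T (map fshift G) A -> nd T G (All A)
  | nd_allE G A t : nd T G (All A) -> nd T G (inst t A)
  | nd_exI G A t : nd T G (inst t A) -> nd T G (Ex A)
  | nd_exE G A B :
      nd T G (Ex A) -> nd T (A :: map fshift G) (fshift B) -> nd T G B
  | nd_refl G t : nd T G (Eq t t)
  | nd_leibniz G t u A :
      nd T G (Eq t u) -> nd T G (inst t A) -> nd T G (inst u A).

Definition proves (T : theory) (A : form) : Prop := nd T [::] A.

Definition consistent (T : theory) : Prop := ~ proves T Bot.

Definition same_theorems (T T' : theory) : Prop :=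
  forall A, proves T A <-> proves T' A.

Definition theory_add (T E : theory) : theory := fun A => T A \/ E A.

Definition ball (t : term) (A : form) : form :=
  All (Imp (Le (Var 0) (tshift t)) A).
Definition bex (t : term) (A : form) : form :=
  Ex (And (Le (Var 0) (tshift t)) A).

Inductive sharply_bounded : form -> Prop :=
  | sb_bot : sharply_bounded Bot
  | sb_eq t u : sharply_bounded (Eq t u)
  | sb_le t u : sharply_bounded (Le t u)
  | sb_imp A B :
      sharply_bounded A -> sharply_bounded B -> sharply_bounded (Imp A B)
  | sb_and A B :
      sharply_bounded A -> sharply_bounded B -> sharply_bounded (And A B)
  | sb_or A B :
      sharply_bounded A -> sharply_bounded B -> sharply_bounded (Or A B)
  | sb_all t A : sharply_bounded A -> sharply_bounded (ball (Len t) A)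
  | sb_ex t A : sharply_bounded A -> sharply_bounded (bex (Len t) A).

(* Sigma^b_1 for [true] and Pi^b_1 for [false]. *)
Inductive sigmab1 : bool -> form -> Prop :=
  | sigmab1_sb p A : sharply_bounded A -> sigmab1 p A
  | sigmab1_imp p A B : sigmab1 (~~ p) A -> sigmab1 p B -> sigmab1 p (Imp A B)
  | sigmab1_and p A B : sigmab1 p A -> sigmab1 p B -> sigmab1 p (And A B)
  | sigmab1_or p A B : sigmab1 p A -> sigmab1 p B -> sigmab1 p (Or A B)
  | sigmab1_sball p t A : sigmab1 p A -> sigmab1 p (ball (Len t) A)
  | sigmab1_sbex p t A : sigmab1 p A -> sigmab1 p (bex (Len t) A)
  | sigmab1_ball t A : sigmab1 false A -> sigmab1 false (ball t A)
  | sigmab1_bex t A : sigmab1 true A -> sigmab1 true (bex t A).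

(* Buss's S^1_2: the 32 axioms BASIC, in Buss's order, and PIND for           *)
(* Sigma^b_1-formulas.                                                        *)

Section Basic.

Let x := Var 0.
Let y := Var 1.
Let z := Var 2.
Let u := Var 2.
Let v := Var 3.
Let one := Succ Zero.
Let two := Succ one.
Let double (t : term) := Mul two t.
Let double1 (t : term) := Succ (Mul two t).
Let neq (s t : term) := Not (Eq s t).

Definition BASIC : seq form :=
  [:: Imp (Le y x) (Le y (Succ x));
      neq x (Succ x);
      Le Zero x;
      Iff (And (Le x y) (neq x y)) (Le (Succ x) y);
      Imp (neq x Zero) (neq (double x) Zero);
      Or (Le y x) (Le x y);
      Imp (And (Le x y) (Le y x)) (Eq x y);
      Imp (And (Le x y) (Le y z)) (Le x z);
      Eq (Len Zero) Zero;
      Imp (neq x Zero) (And (Eq (Len (double x)) (Succ (Len x)))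
                            (Eq (Len (double1 x)) (Succ (Len x))));
      Eq (Len one) one;
      Imp (Le x y) (Le (Len x) (Len y));
      Eq (Len (Smash x y)) (Succ (Mul (Len x) (Len y)));
      Eq (Smash Zero y) one;
      Imp (neq x Zero)
          (And (Eq (Smash one (double x)) (double (Smash one x)))
               (Eq (Smash one (double1 x)) (double (Smash one x))));
      Eq (Smash x y) (Smash y x);
      Imp (Eq (Len x) (Len y)) (Eq (Smash x z) (Smash y z));
      Imp (Eq (Len x) (Add (Len u) (Len v)))
          (Eq (Smash x y) (Mul (Smash u y) (Smash v y)));
      Le x (Add x y);
      Imp (And (Le x y) (neq x y))
          (And (Le (double1 x) (double y)) (neq (double1 x) (double y)));
      Eq (Add x y) (Add y x);
      Eq (Add x Zero) x;
      Eq (Add x (Succ y)) (Succ (Add x y));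
      Eq (Add (Add x y) z) (Add x (Add y z));
      Iff (Le (Add x y) (Add x z)) (Le y z);
      Eq (Mul x Zero) Zero;
      Eq (Mul x (Succ y)) (Add (Mul x y) x);
      Eq (Mul x y) (Mul y x);
      Eq (Mul x (Add y z)) (Add (Mul x y) (Mul x z));
      Imp (Le one x) (Iff (Le (Mul x y) (Mul x z)) (Le y z));
      Imp (neq x Zero) (Eq (Len x) (Succ (Len (Half x))));
      Iff (Eq x (Half y)) (Or (Eq (double x) y) (Eq (double1 x) y))].

End Basic.

Definition PIND (A : form) : form :=
  Imp (And (inst Zero A) (All (Imp (repl (Half (Var 0)) A) A))) (All A).

Definition S12 : theory := fun B =>
  exists2 A, List.In A BASIC \/ (exists2 C, sigmab1 true C & A = PIND C)
           & B = univ_closure A.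

(* Sigma^0_1-formulas, as in Hajek and Pudlak: a block of existential         *)
(* quantifiers followed by a Delta_0-formula, in which quantifiers are        *)
(* bounded by variables other than the quantified one (hence [Var n.+1]).     *)
(* As cuts need not be closed under the function symbols, term bounds would   *)
(* not be preserved by relativisation.                                        *)

Inductive delta0 : form -> Prop :=
  | d0_bot : delta0 Bot
  | d0_eq t u : delta0 (Eq t u)
  | d0_le t u : delta0 (Le t u)
  | d0_imp A B : delta0 A -> delta0 B -> delta0 (Imp A B)
  | d0_and A B : delta0 A -> delta0 B -> delta0 (And A B)
  | d0_or A B : delta0 A -> delta0 B -> delta0 (Or A B)
  | d0_all n A : delta0 A -> delta0 (ball (Var n) A)
  | d0_ex n A : delta0 A -> delta0 (bex (Var n) A).

Inductive sigma1 : form -> Prop :=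
  | sigma1_delta0 A : delta0 A -> sigma1 A
  | sigma1_ex A : sigma1 A -> sigma1 (Ex A).

Definition sigma1_sentence (A : form) : Prop := sigma1 A /\ sentence A.

(* Truth in the standard model.  Note that |n| = up_log 2 n.+1. *)

Fixpoint teval (e : nat -> nat) (t : term) : nat :=
  match t with
  | Var n => e n
  | Zero => 0
  | Succ t => (teval e t).+1
  | Add t u => teval e t + teval e u
  | Mul t u => teval e t * teval e u
  | Half t => (teval e t)./2
  | Len t => up_log 2 (teval e t).+1
  | Smash t u => 2 ^ (up_log 2 (teval e t).+1 * up_log 2 (teval e u).+1)
  end.

Definition env_cons (k : nat) (e : nat -> nat) (n : nat) : nat :=
  if n is n'.+1 then e n' else k.

Fixpoint sat (e : nat -> nat) (A : form) : Prop :=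
  match A with
  | Bot => False
  | Eq t u => teval e t = teval e u
  | Le t u => teval e t <= teval e u
  | Imp A B => sat e A -> sat e B
  | And A B => sat e A /\ sat e B
  | Or A B => sat e A \/ sat e B
  | All A => forall k, sat (env_cons k e) A
  | Ex A => exists k, sat (env_cons k e) A
  end.

Definition true_sentence (A : form) : Prop := sat (fun=> 0) A.

(* A formula I(x) is represented by a formula whose only free variable is     *)
(* [Var 0]; hence no shift of [I] is needed under binders.                    *)

Definition subcut (I J : form) : Prop := proves S12 (All (Imp I J)).

Definition cut (I : form) : Prop :=
  [/\ fv I <= 1,
      proves S12 (inst Zero I),
      proves S12 (All (Imp I (repl (Succ (Var 0)) I)))
    & proves S12
        (All (All (Imp (And (inst (Var 1) I) (Le (Var 0) (Var 1)))
                       (inst (Var 0) I))))].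

Fixpoint relativise (I A : form) : form :=
  match A with
  | Bot => Bot
  | Eq t u => Eq t u
  | Le t u => Le t u
  | Imp A B => Imp (relativise I A) (relativise I B)
  | And A B => And (relativise I A) (relativise I B)
  | Or A B => Or (relativise I A) (relativise I B)
  | All A => All (Imp I (relativise I A))
  | Ex A => Ex (And I (relativise I A))
  end.

(* Depth of quantifier alternations: the maximal number of blocks of like     *)
(* quantifiers along a branch of the formation tree, where the antecedent of  *)
(* an implication (hence also negation) exchanges the roles of the two        *)
(* quantifiers.  The argument [q] records the last quantifier met on the      *)
(* branch: [Some true] for an existential one, [Some false] for a universal   *)
(* one, up to that exchange.                                                  *)

Fixpoint alternations (q : option bool) (A : form) : nat :=
  match A with
  | Bot | Eq _ _ | Le _ _ => 0
  | Imp A B => maxn (alternations (omap negb q) A) (alternations q B)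
  | And A B | Or A B => maxn (alternations q A) (alternations q B)
  | All A => (q != Some false) + alternations (Some false) A
  | Ex A => (q != Some true) + alternations (Some true) A
  end.

Definition rho : form -> nat := alternations None.

Definition rho_axioms (axs : seq form) : nat := \max_(A <- axs) rho A.

Definition finite_axiomatisation (T : theory) (axs : seq form) : Prop :=
  (forall A, List.In A axs -> sentence A) /\
  same_theorems (fun A => List.In A axs) T.

Inductive recf :=
  | RZero
  | RSucc
  | RProj of nat
  | RComp of recf & seq recf
  | RPrim of recf & recf
  | RMu of recf.

(* [eval f v n] means that the partial recursive function f is defined at v   *)
(* with value n.                                                              *)
Inductive eval : recf -> seq nat -> nat -> Prop :=
  | eval_zero v : eval RZero v 0
  | eval_succ n v : eval RSucc (n :: v) n.+1
  | eval_proj i v : i < size v -> eval (RProj i) v (nth 0 v i)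
  | eval_comp f gs v w n :
      evals gs v w -> eval f w n -> eval (RComp f gs) v n
  | eval_prim0 f g v n : eval f v n -> eval (RPrim f g) (0 :: v) n
  | eval_primS f g k v m n :
      eval (RPrim f g) (k :: v) m -> eval g [:: k, m & v] n ->
      eval (RPrim f g) (k.+1 :: v) n
  | eval_mu f v n (h : nat -> nat) :
      (forall k, k < n -> eval f (k :: v) (h k).+1) -> eval f (n :: v) 0 ->
      eval (RMu f) v n
with evals : seq recf -> seq nat -> seq nat -> Prop :=
  | evals_nil v : evals [::] v [::]
  | evals_cons g gs v n w :
      eval g v n -> evals gs v w -> evals (g :: gs) v (n :: w).

Definition recursive (F : nat -> nat) : Prop :=
  exists f, forall n, eval f [:: n] (F n).

Definition rec_enumerable (P : nat -> Prop) : Prop :=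
  exists f, forall n, P n <-> exists k, eval f [:: k] n.

(* Goedel numbering: formulas are written in Polish notation. *)

Fixpoint ttokens (t : term) : seq nat :=
  match t with
  | Zero => [:: 0]
  | Succ t => 1 :: ttokens t
  | Add t u => 2 :: ttokens t ++ ttokens u
  | Mul t u => 3 :: ttokens t ++ ttokens u
  | Half t => 4 :: ttokens t
  | Len t => 5 :: ttokens t
  | Smash t u => 6 :: ttokens t ++ ttokens u
  | Var n => [:: 15 + n]
  end.

Fixpoint ftokens (A : form) : seq nat :=
  match A with
  | Bot => [:: 7]
  | Eq t u => 8 :: ttokens t ++ ttokens u
  | Le t u => 9 :: ttokens t ++ ttokens u
  | Imp A B => 10 :: ftokens A ++ ftokens B
  | And A B => 11 :: ftokens A ++ ftokens B
  | Or A B => 12 :: ftokens A ++ ftokens B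
  | All A => 13 :: ftokens A
  | Ex A => 14 :: ftokens A
  end.

Definition code (A : form) : nat := CodeSeq.code (ftokens A).

(* A Sigma^0_1-formula prov(x) that arithmetises S^1_2-provability, i.e.      *)
(* is true of the Goedel number of a sentence exactly when that sentence is a *)
(* theorem.  The derivability conditions are not demanded, so that results    *)
(* about such formulas cover in particular the standard ones.                 *)
Definition provability_predicate (prov : form) : Prop :=
  [/\ sigma1 prov, fv prov <= 1
    & forall A, sentence A ->
        sat (fun=> code A) prov <-> proves S12 A].

Definition re_theory (T : theory) : Prop :=
  rec_enumerable (fun n => exists2 A, T A & code A = n).

(* T is an extension of S^1_2 of complexity at most m. *)
Definition extension_of_complexity (m : nat) (T : theory) : Prop :=
  (forall A, T A -> sentence A) /\
  exists E : theory,
    (forall A, E A -> sentence A /\ rho A <= m) /\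
    same_theorems T (theory_add S12 E).

Definition sigma1_sound_on (I : form) (T : theory) : Prop :=
  forall A, sigma1_sentence A -> proves T (relativise I A) -> true_sentence A.

Definition enumerates_sigma1 (S : nat -> form) : Prop :=
  (forall n, sigma1_sentence (S n)) /\
  forall A, sigma1_sentence A -> exists n, S n = A.

Definition effective (J : nat -> form) : Prop :=
  recursive (fun n => code (J n)).

Definition descending_cofinal_cuts (J : nat -> form) : Prop :=
  [/\ forall n, cut (J n),
      forall n, subcut (J n.+1) (J n)
    & forall J', cut J' -> exists k, subcut (J k) J'].

Definition U (S I J : nat -> form) : theory :=
  theory_add S12
    (fun A => exists i j,
       A = Imp (relativise (I i) (S i)) (relativise (J j) (S i))).

(* Main.v *)
Require Import Defs.
From Stdlib Require Import Classical.
From Stdlib Require List.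
From mathcomp Require Import all_boot zify.

Set Implicit Arguments.
Unset Strict Implicit.
Unset Printing Implicit Defensive.

(* Diagonalising over a true sentence Phi yields a false Sigma1-sentence S    *)
(* with S12 + Phi + S^I consistent and rho S <= rho prov + 1.  On a cut I,    *)
(* S^I is equivalent to a sentence of complexity at most                      *)
(* max (rho S) (rho I + 1), so soundness of I_{n+1} forces                    *)
(* rho I_{n+1} >= m n, and rho I_n is increasing.                             *)
(* Given Istar, pick n with I_n contained in Istar, and apply this to I_n and *)
(* the conjunction of the ~ S_k^{I_k} with k <= n and S_k false, to obtain    *)
(* S = S_i.  Adding the remaining ~ S_k^{I_k} with S_k false one at a time    *)
(* preserves consistency: the theory reached before step k > n has complexity *)
(* at most m (k - 1), so by soundness of I_k it does not prove S_k^{I_k}.     *)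
(* The limit contains U, since S12 proves S_k^J when S_k is true, and it      *)
(* proves S^Istar but refutes S^{I_i}.                                        *)

(** * Substitution *)

(** A cut on which all theories of low complexity are sound must itself be complex. For any cut,
    [diagonal] gives a false Sigma1-sentence, of complexity at most that of [prov] plus one, whose
    relativisation to the cut is consistent with S12. Were [I n.+1] simpler than [m n], this
    relativisation would be an axiom of complexity at most [m n], and soundness would make the
    sentence true ([m_le_rho]). So the complexities of the I_n grow, and each ~ S_k^{I_k} with k <=
    n fits below [m n].

    Suppose now that a uniform cut [Istar] contains I_n. Take a false S such that S^{I_n} is
    consistent with all refutations ~ S_k^{I_k} of false S_k with k <= n ([stage_base]). Each later
    I_k is sound for the theory built before step k, which therefore cannot prove S_k^{I_k} for a
    false S_k; so the remaining refutations can be added as well ([stage_step]). The limit proves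
    every axiom of U trivially: its premise is refuted or its conclusion is a theorem of S12. But S
    is itself some S_i, so the limit proves S^{I_n}, hence S^Istar, and refutes S^{I_i}.

    The complexity count needs two devices. S^I is replaced by an equivalent in which only leading
    existential quantifiers are relativised ([delta0_relativise], [rho_ex_cut]). Self-reference is
    obtained from a quantifier-free equation between codes ([code_exp2_term]) instead of an
    arithmetised substitution function. *)

Lemma tsubst_eq_tfv t s s' :
  (forall n, n < tfv t -> s n = s' n) -> tsubst s t = tsubst s' t.
Proof.
elim: t => //= [n|t IH|t IHt u IHu|t IHt u IHu|t IH|t IH|t IHt u IHu] H;
  rewrite ?IH //; try exact: H;
  by rewrite IHt ?IHu // => n Hn; apply: H; rewrite leq_max Hn ?orbT.
Qed.

Lemma up_eq s s' k :
  (forall n, n < k.-1 -> s n = s' n) -> forall n, n < k -> up s n = up s' n.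
Proof. by move=> H [|n] //= Hn; rewrite /up /= H //; lia. Qed.

Lemma fsubst_eq_fv A s s' :
  (forall n, n < fv A -> s n = s' n) -> fsubst s A = fsubst s' A.
Proof.
elim: A s s' => //= [t u|t u|A IHA B IHB|A IHA B IHB|A IHA B IHB|A IH|A IH] s s' H.
1,2: rewrite (@tsubst_eq_tfv t s s') ?(@tsubst_eq_tfv u s s') // => n Hn;
  by apply: H; rewrite leq_max Hn ?orbT.
1-3: rewrite (IHA s s') ?(IHB s s') // => n Hn;
  by apply: H; rewrite leq_max Hn ?orbT.
1,2: by rewrite (IH (up s) (up s')) //; apply: up_eq.
Qed.

Lemma fsubst_ext A s s' : s =1 s' -> fsubst s A = fsubst s' A.
Proof. by move=> H; apply: fsubst_eq_fv => n _. Qed.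

Lemma tsubst_id t : tsubst Var t = t.
Proof. by elim: t => //= [t->|t->u->|t->u->|t->|t->|t->u->]. Qed.

Lemma up_id : up Var =1 Var.
Proof. by case. Qed.

Lemma fsubst_id A : fsubst Var A = A.
Proof.
elim: A => //= [t u|t u|A->B->|A->B->|A->B->|A IH|A IH] //;
  by rewrite ?tsubst_id // (fsubst_ext _ up_id) IH.
Qed.

Lemma tsubst_comp s s' t :
  tsubst s (tsubst s' t) = tsubst (fun n => tsubst s (s' n)) t.
Proof. by elim: t => //= [t->|t->u->|t->u->|t->|t->|t->u->]. Qed.

Lemma up_comp s s' :
  (fun n => tsubst (up s) (up s' n)) =1 up (fun n => tsubst s (s' n)).
Proof. by case=> //= n; rewrite /tshift !tsubst_comp. Qed.

Lemma fsubst_comp s s' A :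
  fsubst s (fsubst s' A) = fsubst (fun n => tsubst s (s' n)) A.
Proof.
elim: A s s' => //= [t u|t u|A IHA B IHB|A IHA B IHB|A IHA B IHB|A IH|A IH] s s';
  rewrite ?tsubst_comp ?IHA ?IHB ?IH //; by rewrite (fsubst_ext _ (@up_comp s s')).
Qed.

Lemma sentence_fsubst A s : sentence A -> fsubst s A = A.
Proof.
by move=> H; rewrite -[RHS]fsubst_id; apply: fsubst_eq_fv => n; rewrite H.
Qed.

Lemma tinst_tshift t u : tsubst (scons u Var) (tshift t) = t.
Proof. by rewrite /tshift tsubst_comp /= tsubst_id. Qed.

Lemma inst_up t s A : inst t (fsubst (up s) A) = fsubst (scons t s) A.
Proof.
rewrite /inst fsubst_comp; apply: fsubst_ext => -[|n] //=.
by rewrite tinst_tshift.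
Qed.

Lemma fsubst_inst1 s t I :
  fv I <= 1 -> fsubst s (inst t I) = inst (tsubst s t) I.
Proof.
by move=> H; rewrite /inst fsubst_comp; apply: fsubst_eq_fv => -[|n] //=; lia.
Qed.

Lemma fsubst_fv1 s I : fv I <= 1 -> fsubst s I = inst (s 0) I.
Proof. by move=> H; apply: fsubst_eq_fv => -[|n] //=; lia. Qed.

Lemma inst_var0 I : fv I <= 1 -> inst (Var 0) I = I.
Proof. by move=> H; rewrite -[RHS]fsubst_id (fsubst_fv1 _ H). Qed.

(** * Natural deduction *)

Lemma In_map (X Y : Type) (f : X -> Y) x s : List.In x s -> List.In (f x) (map f s).
Proof. by elim: s => //= y s IH [->|/IH]; [left|right]. Qed.

Lemma In_mapE (X Y : Type) (f : X -> Y) y s :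
  List.In y (map f s) -> exists2 x, List.In x s & y = f x.
Proof.
elim: s => //= x s IH [<-|/IH[z Hz ->]]; first by exists x; [left|].
by exists z; [right|].
Qed.

Lemma nd_mono (T T' : theory) G G' A :
  nd T G A -> (forall B H, T B -> nd T' H B) ->
  (forall B, List.In B G -> List.In B G') -> nd T' G' A.
Proof.
move=> D HT; elim: D G' => {G A}.
- by move=> G A TA G' _; apply: HT.
- by move=> G A HA G' HG; apply/nd_hyp/HG.
- move=> G A _ IH G' HG; apply/nd_raa/IH => B [<-|/HG]; by [left|right].
- move=> G A B _ IH G' HG; apply/nd_impI/IH => C [<-|/HG]; by [left|right].
- by move=> G A B _ IHA _ IHB G' HG; apply: nd_impE (IHA _ HG) (IHB _ HG).
- by move=> G A B _ IHA _ IHB G' HG; apply: nd_andI (IHA _ HG) (IHB _ HG).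
- by move=> G A B _ IH G' HG; apply: nd_andEl (IH _ HG).
- by move=> G A B _ IH G' HG; apply: nd_andEr (IH _ HG).
- by move=> G A B _ IH G' HG; apply: nd_orIl (IH _ HG).
- by move=> G A B _ IH G' HG; apply: nd_orIr (IH _ HG).
- move=> G A B C _ IH _ IHA _ IHB G' HG; apply: nd_orE (IH _ HG) _ _.
    by apply: IHA => D [<-|/HG]; [left|right].
  by apply: IHB => D [<-|/HG]; [left|right].
- move=> G A _ IH G' HG; apply: nd_allI; apply: IH => B HB.
  by have [C /HG HC ->] := In_mapE HB; apply: In_map.
- by move=> G A t _ IH G' HG; apply: nd_allE (IH _ HG).
- by move=> G A t _ IH G' HG; apply: nd_exI (IH _ HG).
- move=> G A B _ IH _ IHB G' HG; apply: nd_exE (IH _ HG) _; apply: IHB.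
  move=> C [<-|HC]; first by left.
  by have [D /HG HD ->] := In_mapE HC; right; apply: In_map.
- by move=> *; apply: nd_refl.
- by move=> G t u A _ IHe _ IHA G' HG; apply: nd_leibniz (IHe _ HG) (IHA _ HG).
Qed.

Lemma nd_weak T G G' A :
  (forall B, List.In B G -> List.In B G') -> nd T G A -> nd T G' A.
Proof. by move=> HG D; apply: nd_mono D _ HG => B H; apply: nd_ax. Qed.

Lemma nd_proves T G A : proves T A -> nd T G A.
Proof. by apply: nd_weak. Qed.

Lemma nd_theory (T T' : theory) G A :
  (forall B, T B -> proves T' B) -> nd T G A -> nd T' G A.
Proof. by move=> HT D; apply: nd_mono D _ _ => // B H /HT; apply: nd_proves. Qed.

Lemma nd_sub (T T' : theory) G A :
  (forall B, T B -> T' B) -> nd T G A -> nd T' G A.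
Proof. by move=> HT; apply: nd_theory => B /HT; apply: nd_ax. Qed.

Lemma nd_wk T G A B : nd T G A -> nd T (B :: G) A.
Proof. by apply: nd_weak => C; right. Qed.

Lemma nd_hyp0 T G A : nd T (A :: G) A.
Proof. by apply: nd_hyp; left. Qed.

Lemma nd_hyp1 T G A B : nd T [:: B, A & G] A.
Proof. exact/nd_wk/nd_hyp0. Qed.

Lemma nd_cut T G A B : nd T G A -> nd T (A :: G) B -> nd T G B.
Proof. by move=> HA HB; apply: nd_impE HA; apply: nd_impI. Qed.

Lemma nd_absurd T G A B : nd T G (Not A) -> nd T G A -> nd T G B.
Proof. by move=> HN HA; apply/nd_raa/nd_wk; apply: nd_impE HN HA. Qed.

Lemma nd_em T G A C : nd T (A :: G) C -> nd T (Not A :: G) C -> nd T G C.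
Proof.
move=> HA HN; have HAC := nd_impI HA; have HNC := nd_impI HN.
apply: nd_raa; apply: nd_impE (nd_hyp0 _ _ _) _.
apply: nd_impE (nd_wk _ HNC) _; apply: nd_impI.
apply: nd_impE (nd_hyp1 _ _ _ _) _.
exact: nd_impE (nd_wk _ (nd_wk _ HAC)) (nd_hyp0 _ _ _).
Qed.

(** Sentences are fixed by [fshift], so [L] passes unchanged through the rules that shift the
    context. *)
Lemma nd_deduction (T E : theory) (L G : seq form) A :
  (forall B, E B -> List.In B L) -> (forall B, List.In B L -> sentence B) ->
  nd (theory_add T E) G A -> nd T (L ++ G) A.
Proof.
move=> HE HL D; elim: D => {G A}.
- move=> G A [TA|/HE LA]; first exact: nd_ax.
  by apply/nd_hyp/List.in_or_app; left.
- by move=> G A HA; apply/nd_hyp/List.in_or_app; right.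
- move=> G A _ IH; apply: nd_raa; apply: nd_weak IH => B.
  by rewrite /= !List.in_app_iff /=; tauto.
- move=> G A B _ IH; apply: nd_impI; apply: nd_weak IH => C.
  by rewrite /= !List.in_app_iff /=; tauto.
- by move=> G A B _ IHA _ IHB; apply: nd_impE IHA IHB.
- by move=> G A B _ IHA _ IHB; apply: nd_andI IHA IHB.
- by move=> G A B _ IH; apply: nd_andEl IH.
- by move=> G A B _ IH; apply: nd_andEr IH.
- by move=> G A B _ IH; apply: nd_orIl IH.
- by move=> G A B _ IH; apply: nd_orIr IH.
- move=> G A B C _ IH _ IHA _ IHB; apply: nd_orE IH _ _.
    by apply: nd_weak IHA => D; rewrite /= !List.in_app_iff /=; tauto.
  by apply: nd_weak IHB => D; rewrite /= !List.in_app_iff /=; tauto.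
- move=> G A _ IH; apply: nd_allI; apply: nd_weak IH => B.
  rewrite map_cat !List.in_app_iff => -[HB|]; last by right.
  left; rewrite -(sentence_fsubst (fun n => Var n.+1) (HL _ HB)).
  exact: In_map.
- by move=> G A t _ IH; apply: nd_allE IH.
- by move=> G A t _ IH; apply: nd_exI IH.
- move=> G A B _ IH _ IHB; apply: nd_exE IH _; apply: nd_weak IHB => C.
  rewrite map_cat /= !List.in_app_iff /= => -[HC|[->|]]; last by right; right.
    right; left; rewrite -(sentence_fsubst (fun n => Var n.+1) (HL _ HC)).
    exact: In_map.
  by left.
- by move=> *; apply: nd_refl.
- by move=> G t u A _ IHe _ IHA; apply: nd_leibniz IHe IHA.
Qed.

(** A derivation uses finitely many axioms, so in an increasing union they all lie in one member. *)
Lemma nd_compact (T : nat -> theory) G A :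
  (forall k l B, k <= l -> T k B -> T l B) ->
  nd (fun B => exists l, T l B) G A -> exists l, nd (T l) G A.
Proof.
move=> HT; have up k l H B : k <= l -> nd (T k) H B -> nd (T l) H B.
  by move=> kl; apply: nd_sub => C; apply: HT.
elim=> {G A}.
- by move=> G A [l Hl]; exists l; apply: nd_ax.
- by move=> G A HA; exists 0; apply: nd_hyp.
- by move=> G A _ [l IH]; exists l; apply: nd_raa.
- by move=> G A B _ [l IH]; exists l; apply: nd_impI.
- move=> G A B _ [k IHA] _ [l IHB]; exists (maxn k l).
  by apply: (@nd_impE _ _ A); [apply: up IHA|apply: up IHB]; lia.
- move=> G A B _ [k IHA] _ [l IHB]; exists (maxn k l).
  by apply: nd_andI; [apply: up IHA|apply: up IHB]; lia.
- by move=> G A B _ [l IH]; exists l; apply: nd_andEl IH.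
- by move=> G A B _ [l IH]; exists l; apply: nd_andEr IH.
- by move=> G A B _ [l IH]; exists l; apply: nd_orIl IH.
- by move=> G A B _ [l IH]; exists l; apply: nd_orIr IH.
- move=> G A B C _ [j IH] _ [k IHA] _ [l IHB]; exists (maxn j (maxn k l)).
  by apply: (@nd_orE _ _ A B); [apply: up IH|apply: up IHA|apply: up IHB]; lia.
- by move=> G A _ [l IH]; exists l; apply: nd_allI.
- by move=> G A t _ [l IH]; exists l; apply: nd_allE IH.
- by move=> G A t _ [l IH]; exists l; apply: nd_exI IH.
- move=> G A B _ [k IH] _ [l IHB]; exists (maxn k l).
  by apply: (@nd_exE _ _ A); [apply: up IH|apply: up IHB]; lia.
- by move=> G t; exists 0; apply: nd_refl.
- move=> G t u A _ [k IHe] _ [l IHA]; exists (maxn k l).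
  by apply: (@nd_leibniz _ _ t); [apply: up IHe|apply: up IHA]; lia.
Qed.

Lemma nd_iter_all T G k A s s' :
  nd T G (fsubst s (iter k All A)) -> (forall n, s' (n + k) = s n) ->
  nd T G (fsubst s' A).
Proof.
elim: k s => [|k IH] s /= D Hs.
  by rewrite (@fsubst_ext A s' s) // => n; rewrite -Hs addn0.
apply: (IH (scons (s' k) s)); first by rewrite -inst_up; apply: nd_allE.
by case=> [|n] //=; rewrite addSnnS Hs.
Qed.

Lemma nd_univ_closure T G A s : nd T G (univ_closure A) -> nd T G (fsubst s A).
Proof.
(* Stripping [fv A] quantifiers lowers the indices from [fv A] on; [s'] agrees with [s] on the
   variables that occur in [A]. *)
move=> D; pose s' n := if n < fv A then s n else Var (n - fv A).
rewrite (@fsubst_eq_fv A s s'); last by move=> n Hn; rewrite /s' Hn.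
apply: (@nd_iter_all _ _ (fv A) A Var); first by rewrite fsubst_id.
by move=> n; rewrite /s' ltnNge leq_addl addnK.
Qed.

(** * Equality: symmetry, transitivity and congruence, from the Leibniz rule *)

Lemma nd_eq_sym T G t u : nd T G (Eq t u) -> nd T G (Eq u t).
Proof.
move=> D; have := @nd_leibniz T G t u (Eq (Var 0) (tshift t)) D.
by rewrite /inst /= !tinst_tshift; apply; apply: nd_refl.
Qed.

Lemma nd_eq_trans T G t u v :
  nd T G (Eq t u) -> nd T G (Eq u v) -> nd T G (Eq t v).
Proof.
move=> Dt Du; have := @nd_leibniz T G u v (Eq (tshift t) (Var 0)) Du.
by rewrite /inst /= !tinst_tshift; apply.
Qed.

Lemma nd_eq_congr T G t u c : nd T G (Eq t u) ->
  nd T G (Eq (tsubst (scons t Var) c) (tsubst (scons u Var) c)).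
Proof.
move=> D; set w := tsubst _ c.
have := @nd_leibniz T G t u (Eq (tshift w) c) D.
by rewrite /inst /= !tinst_tshift; apply; apply: nd_refl.
Qed.

Lemma nd_eq_succ T G t u : nd T G (Eq t u) -> nd T G (Eq (Succ t) (Succ u)).
Proof. by move/(nd_eq_congr (Succ (Var 0))). Qed.

Lemma nd_eq_half T G t u : nd T G (Eq t u) -> nd T G (Eq (Half t) (Half u)).
Proof. by move/(nd_eq_congr (Half (Var 0))). Qed.

Lemma nd_eq_len T G t u : nd T G (Eq t u) -> nd T G (Eq (Len t) (Len u)).
Proof. by move/(nd_eq_congr (Len (Var 0))). Qed.

Lemma nd_eq_add T G t u t' u' :
  nd T G (Eq t u) -> nd T G (Eq t' u') -> nd T G (Eq (Add t t') (Add u u')).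
Proof.
move/(nd_eq_congr (Add (Var 0) (tshift t'))) => D.
move/(nd_eq_congr (Add (tshift u) (Var 0))) => D'.
by move: D D'; rewrite /= !tinst_tshift; apply: nd_eq_trans.
Qed.

Lemma nd_eq_mul T G t u t' u' :
  nd T G (Eq t u) -> nd T G (Eq t' u') -> nd T G (Eq (Mul t t') (Mul u u')).
Proof.
move/(nd_eq_congr (Mul (Var 0) (tshift t'))) => D.
move/(nd_eq_congr (Mul (tshift u) (Var 0))) => D'.
by move: D D'; rewrite /= !tinst_tshift; apply: nd_eq_trans.
Qed.

Lemma nd_eq_smash T G t u t' u' :
  nd T G (Eq t u) -> nd T G (Eq t' u') -> nd T G (Eq (Smash t t') (Smash u u')).
Proof.
move/(nd_eq_congr (Smash (Var 0) (tshift t'))) => D.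
move/(nd_eq_congr (Smash (tshift u) (Var 0))) => D'.
by move: D D'; rewrite /= !tinst_tshift; apply: nd_eq_trans.
Qed.

Lemma nd_eq_le T G t u t' u' :
  nd T G (Eq t u) -> nd T G (Eq t' u') -> nd T G (Le t t') -> nd T G (Le u u').
Proof.
move=> D D' H; have := @nd_leibniz T G t u (Le (Var 0) (tshift t')) D.
rewrite /inst /= !tinst_tshift => /(_ H) {}H.
have := @nd_leibniz T G t' u' (Le (tshift u) (Var 0)) D'.
by rewrite /inst /= !tinst_tshift; apply.
Qed.

(** * Truth in the standard model *)

Lemma teval_eq_tfv t e e' :
  (forall n, n < tfv t -> e n = e' n) -> teval e t = teval e' t.
Proof.
elim: t => //= [n|t IH|t IHt u IHu|t IHt u IHu|t IH|t IH|t IHt u IHu] H;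
  rewrite ?IH //; try exact: H;
  by rewrite IHt ?IHu // => n Hn; apply: H; rewrite leq_max Hn ?orbT.
Qed.

Lemma sat_eq_fv A e e' :
  (forall n, n < fv A -> e n = e' n) -> sat e A <-> sat e' A.
Proof.
have cons_eq k a e1 e2 : (forall n, n < k.-1 -> e1 n = e2 n) ->
    forall n, n < k -> env_cons a e1 n = env_cons a e2 n.
  by move=> H [|n] //= Hn; apply: H; lia.
elim: A e e' => //= [t u|t u|A IHA B IHB|A IHA B IHB|A IHA B IHB|A IH|A IH] e e' H.
1,2: rewrite (@teval_eq_tfv t e e') ?(@teval_eq_tfv u e e') // => n Hn;
  by apply: H; rewrite leq_max Hn ?orbT.
1-3: rewrite (IHA e e') ?(IHB e e') // => n Hn;
  by apply: H; rewrite leq_max Hn ?orbT.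
- by split=> Ha k; move: (Ha k); rewrite (IH _ (env_cons k e')) //; apply: cons_eq.
- by split=> -[k Hk]; exists k; move: Hk; rewrite (IH _ (env_cons k e')) //;
    apply: cons_eq.
Qed.

Lemma sat_ext A e e' : e =1 e' -> sat e A <-> sat e' A.
Proof. by move=> H; apply: sat_eq_fv => n _. Qed.

Lemma teval_subst e s t : teval e (tsubst s t) = teval (fun n => teval e (s n)) t.
Proof. by elim: t => //= [t->|t->u->|t->u->|t->|t->|t->u->]. Qed.

Lemma sat_subst e s A : sat e (fsubst s A) <-> sat (fun n => teval e (s n)) A.
Proof.
have upE s' e' k : (fun n => teval (env_cons k e') (up s' n))
    =1 env_cons k (fun n => teval e' (s' n)).
  by case=> //= n; rewrite /tshift teval_subst.
elim: A e s => //= [t u|t u|A IHA B IHB|A IHA B IHB|A IHA B IHB|A IH|A IH] e s;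
  rewrite ?teval_subst ?IHA ?IHB //.
- by split=> H k; move: (H k); rewrite IH (sat_ext _ (upE s e k)).
- by split=> -[k Hk]; exists k; move: Hk; rewrite IH (sat_ext _ (upE s e k)).
Qed.

Lemma sat_inst e t A : sat e (inst t A) <-> sat (env_cons (teval e t) e) A.
Proof. by rewrite /inst sat_subst; apply: sat_ext; case. Qed.

Lemma sat_fshift e k A : sat (env_cons k e) (fshift A) <-> sat e A.
Proof. by rewrite /fshift sat_subst; apply: sat_ext. Qed.

Lemma nd_sound T G A :
  nd T G A -> (forall B, T B -> forall e, sat e B) ->
  forall e, (forall B, List.In B G -> sat e B) -> sat e A.
Proof.
move=> D HT; elim: D => {G A} /=.
- by move=> G A /HT H e _.
- by move=> G A HA e; apply.
- move=> G A _ IH e HG; apply: NNPP => HA; apply: (IH e) => B [<-|/HG] //=.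
- by move=> G A B _ IH e HG HA; apply: IH => C [<-|/HG].
- by move=> G A B _ IHA _ IHB e HG; apply: (IHA e HG); apply: IHB.
- by move=> G A B _ IHA _ IHB e HG; split; [apply: IHA|apply: IHB].
- by move=> G A B _ IH e HG; case: (IH e HG).
- by move=> G A B _ IH e HG; case: (IH e HG).
- by move=> G A B _ IH e HG; left; apply: IH.
- by move=> G A B _ IH e HG; right; apply: IH.
- move=> G A B C _ IH _ IHA _ IHB e HG; case: (IH e HG) => H.
    by apply: IHA => D [<-|/HG].
  by apply: IHB => D [<-|/HG].
- move=> G A _ IH e HG k; apply: IH => B HB.
  by have [C HC ->] := In_mapE HB; apply/sat_fshift/HG.
- by move=> G A t _ IH e HG; apply/sat_inst/IH.
- by move=> G A t _ IH e HG; exists (teval e t); apply/sat_inst/IH.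
- move=> G A B _ IH _ IHB e HG; have [k Hk] := IH e HG.
  apply/(sat_fshift _ k)/IHB => C [<-|HC] //.
  by have [D HD ->] := In_mapE HC; apply/sat_fshift/HG.
- by [].
- move=> G t u A _ IHe _ IHA e HG; apply/sat_inst.
  by rewrite -(IHe e HG); apply/sat_inst/IHA.
Qed.

Lemma sat_iter_all k A e : (forall e', sat e' A) -> sat e (iter k All A).
Proof. by move=> H; elim: k e => [|k IH] e //=. Qed.

Notation bitlen n := (up_log 2 n.+1).

Lemma bitlen_half n : 0 < n -> bitlen n = (bitlen n./2).+1.
Proof. exact: up_log2S. Qed.

Lemma bitlen_exp2 k : bitlen (2 ^ k) = k.+1.
Proof.
elim: k => [|k IH] //; rewrite bitlen_half ?expn_gt0 //.
by rewrite expnS mul2n doubleK IH.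
Qed.

Lemma bitlen_double n : 0 < n -> bitlen (2 * n) = (bitlen n).+1.
Proof. by move=> n0; rewrite bitlen_half ?mul2n ?doubleK //; lia. Qed.

Lemma bitlen_double1 n : bitlen (2 * n).+1 = (bitlen n).+1.
Proof. by rewrite bitlen_half //; congr (up_log 2 _.+1).+1; lia. Qed.

Lemma BASIC_sound A e : List.In A BASIC -> sat e A.
Proof.
rewrite /BASIC /=.
do 32?case=> [<- /=|]; last by [].
all: move: (e 0) (e 1) (e 2) (e 3) => x y z v.
all: try by rewrite ?(up_log1 2) ?up_lognn ?muln0 ?mul0n ?mulnS ?mulnDr; lia.
- by move/eqP; rewrite -lt0n => x0; rewrite bitlen_double ?bitlen_double1.
- by move=> xy; apply: leq_up_log.
- exact: bitlen_exp2.
- move/eqP; rewrite -lt0n => x0.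
  by rewrite bitlen_double ?bitlen_double1 // mulnS expnD.
- by rewrite mulnC.
- by move=> ->.
- by move=> ->; rewrite mulnDl expnD.
- by move=> x0; rewrite leq_pmul2l.
- by move/eqP; rewrite -lt0n; apply: bitlen_half.
Qed.

(** Repeated halving reaches 0; the auxiliary bound [k] turns the induction on [n] into a strong
    one. *)
Lemma PIND_sound A e : sat e (PIND A).
Proof.
rewrite /PIND /= => -[/sat_inst H0 HS] n; move: {2}n (leqnn n) => k.
elim: k n => [|k IH] n; first by rewrite leqn0 => /eqP ->.
case: (posnP n) => [->//|n0] nk; apply: HS.
rewrite /repl sat_subst; apply/(sat_ext _ (e' := env_cons n./2 e)); first by case.
by apply: IH; lia.
Qed.

Lemma S12_sound A e : S12 A -> sat e A.
Proof.
case=> B HB ->; apply: sat_iter_all => e'; case: HB => [|[C _ ->]].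
- exact: BASIC_sound.
- exact: PIND_sound.
Qed.

Lemma proves_S12_sound A e : proves S12 A -> sat e A.
Proof. by move/nd_sound; apply=> // B H e'; apply: S12_sound. Qed.

(** The closure properties are theorems of S12, hence true, so ordinary induction puts every
    standard number into the cut. *)
Lemma cut_sound I k e : cut I -> sat (env_cons k e) I.
Proof.
case=> _ /(@proves_S12_sound _ e)/sat_inst H0 /(@proves_S12_sound _ e) /= HS _.
elim: k => [|k /HS] //; rewrite /repl sat_subst.
by apply: (proj1 (sat_ext _ _)); case.
Qed.

Lemma sat_relativise I A e : cut I -> sat e (relativise I A) <-> sat e A.
Proof.
move=> HI; elim: A e => //= [A IHA B IHB|A IHA B IHB|A IHA B IHB|A IH|A IH] e;
  rewrite ?IHA ?IHB //.
- by split=> H k; move: (H k); rewrite IH //; apply; apply: cut_sound.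
- split=> -[k Hk]; exists k; first by case: Hk => _ /IH.
  by rewrite IH; split=> //; apply: cut_sound.
Qed.

(** * Evaluation of closed terms in S12 *)

Definition num (n : nat) : term := iter n Succ Zero.
Arguments num : simpl never.

Lemma numS n : num n.+1 = Succ (num n). Proof. by []. Qed.

Lemma tsubst_num s n : tsubst s (num n) = num n.
Proof. by elim: n => // n IH; rewrite numS /= IH. Qed.

Lemma teval_num e n : teval e (num n) = n.
Proof. by elim: n => // n IH; rewrite numS /= IH. Qed.

Lemma tfv_num n : tfv (num n) = 0.
Proof. by elim: n. Qed.

Lemma In_nth (X : Type) (x : X) s i : i < size s -> List.In (nth x s i) s.
Proof. by elim: s i => // y s IH [|i] /=; [left|right; apply: IH]. Qed.

(** Axioms are numbered from 0; [ts] lists the values of x, y, z (or u), v, with [Zero] for those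
    omitted. *)
Lemma nd_basic i ts G : i < 32 -> nd S12 G (fsubst (nth Zero ts) (nth Bot BASIC i)).
Proof.
move=> Hi; apply: nd_univ_closure; apply: nd_ax.
exists (nth Bot BASIC i) => //; left.
by apply: In_nth.
Qed.

Section Rules.

Variable G : seq form.

Local Notation "|- A" := (nd S12 G A) (at level 99).

Lemma nd_le_succ t u : (|- Le t u) -> |- Le t (Succ u).
Proof. exact: nd_impE (@nd_basic 0 [:: u; t] G isT). Qed.

Lemma nd_le0 t : |- Le Zero t.
Proof. exact: (@nd_basic 2 [:: t] G isT). Qed.

Lemma nd_lt t u : (|- Le t u) -> (|- Not (Eq t u)) -> |- Le (Succ t) u.
Proof.
move=> H H'; apply: nd_impE (nd_andEl (@nd_basic 3 [:: t; u] G isT)) _.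
exact: nd_andI.
Qed.

Lemma nd_lt_neq t u : (|- Le (Succ t) u) -> |- Not (Eq t u).
Proof.
move=> H; apply: nd_andEr.
exact: nd_impE (nd_andEr (@nd_basic 3 [:: t; u] G isT)) H.
Qed.

Lemma nd_le_total t u : |- Or (Le u t) (Le t u).
Proof. exact: (@nd_basic 5 [:: t; u] G isT). Qed.

Lemma nd_le_antisym t u : (|- Le t u) -> (|- Le u t) -> |- Eq t u.
Proof.
move=> H H'; apply: nd_impE (@nd_basic 6 [:: t; u] G isT) _.
exact: nd_andI.
Qed.

Lemma nd_le_refl t : |- Le t t.
Proof. by apply: nd_orE (nd_le_total t t) _ _; apply: nd_hyp0. Qed.

Lemma nd_eq_leq t u : (|- Eq t u) -> |- Le t u.
Proof. by move=> H; apply: nd_eq_le (nd_refl _ _ t) H (nd_le_refl t). Qed.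

Lemma nd_le_num a b : a <= b -> |- Le (num a) (num b).
Proof.
elim: b => [|b IH]; first by rewrite leqn0 => /eqP ->; apply: nd_le_refl.
rewrite leq_eqVlt => /orP[/eqP->|/IH H]; first exact: nd_le_refl.
exact: nd_le_succ.
Qed.

Lemma nd_neq_num a b : a != b -> |- Not (Eq (num a) (num b)).
Proof.
rewrite neq_ltn => /orP[ab|ba]; first by apply/nd_lt_neq/(@nd_le_num a.+1).
apply: nd_impI; apply: nd_impE (nd_wk _ _) (nd_eq_sym (nd_hyp0 _ _ _)).
exact/nd_lt_neq/(@nd_le_num b.+1).
Qed.

Definition ev t n := |- Eq t (num n).

Lemma ev_num n : ev (num n) n. Proof. exact: nd_refl. Qed.

Lemma ev_eq t u n : (|- Eq t u) -> ev u n -> ev t n.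
Proof. exact: nd_eq_trans. Qed.

Lemma ev_succ t n : ev t n -> ev (Succ t) n.+1.
Proof. exact: nd_eq_succ. Qed.

Lemma ev_add t u a b : ev t a -> ev u b -> ev (Add t u) (a + b).
Proof.
move=> Ht Hu; apply: ev_eq (nd_eq_add Ht Hu) _ => {Ht Hu}.
elim: b => [|b IH]; first by rewrite addn0; exact: (@nd_basic 21 [:: num a] G isT).
rewrite addnS; apply: ev_eq (@nd_basic 22 [:: num a; num b] G isT) _.
exact: ev_succ.
Qed.

Lemma ev_mul t u a b : ev t a -> ev u b -> ev (Mul t u) (a * b).
Proof.
move=> Ht Hu; apply: ev_eq (nd_eq_mul Ht Hu) _ => {Ht Hu}.
elim: b => [|b IH]; first by rewrite muln0; exact: (@nd_basic 25 [:: num a] G isT).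
rewrite mulnSr; apply: ev_eq (@nd_basic 26 [:: num a; num b] G isT) _.
exact/ev_add/ev_num.
Qed.

Lemma ev_double k : ev (Mul (Succ (Succ Zero)) (num k)) k.*2.
Proof. by rewrite -mul2n; apply: (@ev_mul (num 2)); apply: ev_num. Qed.

Lemma ev_half t n : ev t n -> ev (Half t) n./2.
Proof.
move=> Ht; apply: ev_eq (nd_eq_half Ht) _ => {Ht}; apply: nd_eq_sym.
apply: nd_impE (nd_andEr (@nd_basic 31 [:: num n./2; num n] G isT)) _.
have := odd_double_half n; case: (odd n); rewrite ?add1n ?add0n => H.
- by apply: nd_orIr; have := ev_succ (ev_double n./2); rewrite H.
- by apply: nd_orIl; have := ev_double n./2; rewrite H.
Qed.

Lemma nd_num_neq0 n : 0 < n -> |- Not (Eq (num n) Zero).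
Proof. by move=> n0; apply: (@nd_neq_num n 0); lia. Qed.

Lemma ev_len t n : ev t n -> ev (Len t) (bitlen n).
Proof.
move=> Ht; apply: ev_eq (nd_eq_len Ht) _ => {t Ht}; move: {2}n (leqnn n) => k.
elim: k n => [|k IH] n.
  by rewrite leqn0 => /eqP ->; exact: (@nd_basic 8 [::] G isT).
case: (posnP n) => [->|n0] nk; first by exact: (@nd_basic 8 [::] G isT).
rewrite bitlen_half //; have := odd_double_half n.
(* The length axiom for 2x and 2x + 1 assumes x nonzero, so n = 1 has to be treated by its own
   axiom. *)
case: (posnP n./2) => [->|h0] H.
  have -> : n = 1 by move: H n0; rewrite addn0; case: (odd n) => <-.
  exact: (@nd_basic 10 [::] G isT).
have Hb := @nd_basic 9 [:: num n./2] G isT.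
have {}Hb := nd_impE Hb (nd_num_neq0 h0).
have HI : ev (Succ (Len (num n./2))) (bitlen n./2).+1.
  by apply/ev_succ/IH; lia.
have {H}-> : num n = num (odd n + n./2.*2) by rewrite H.
case: (odd n); rewrite ?add1n ?add0n.
- apply: ev_eq (nd_eq_len (nd_eq_sym (ev_succ (ev_double _)))) _.
  exact: ev_eq (nd_andEr Hb) HI.
- apply: ev_eq (nd_eq_len (nd_eq_sym (ev_double _))) _.
  exact: ev_eq (nd_andEl Hb) HI.
Qed.

Lemma nd_ev_eq t u n : ev t n -> ev u n -> |- Eq t u.
Proof. by move=> Ht /nd_eq_sym; apply: nd_eq_trans. Qed.

Lemma nd_smashC t u : |- Eq (Smash t u) (Smash u t).
Proof. exact: (@nd_basic 15 [:: t; u] G isT). Qed.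

(* With w = 1 # 1, the two ways of computing 2 # 1 give w * w = w * 2, and    *)
(* |w| = 2 rules out w = 0.                                                   *)
Lemma ev_smash11 : ev (Smash (num 1) (num 1)) 2.
Proof.
set w := Smash _ _.
have Hlen : ev (Len w) 2.
  apply: ev_eq (@nd_basic 12 [:: num 1; num 1] G isT) _.
  by apply/ev_succ/(@ev_mul _ _ 1 1); apply: (@ev_len _ 1); apply: ev_num.
have Hw0 : |- Not (Eq Zero w).
  apply: nd_impI; apply: nd_impE (nd_wk _ (@nd_neq_num 0 2 isT)) _.
  apply: nd_eq_trans (nd_wk _ Hlen).
  apply: nd_eq_trans (nd_eq_len (nd_hyp0 _ _ _)).
  exact/nd_wk/nd_eq_sym/(@nd_basic 8 [::] G isT).
have Hw1 := nd_lt (nd_le0 w) Hw0.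
have H2 : |- Eq (Smash (num 2) (num 1)) (Mul w w).
  apply: nd_impE (@nd_basic 17 [:: num 2; num 1; num 1; num 1] G isT) _.
  apply: (@nd_ev_eq _ _ 2); first by apply: (@ev_len _ 2); apply: ev_num.
  by apply: (@ev_add _ _ 1 1); apply: (@ev_len _ 1); apply: ev_num.
have H2' : |- Eq (Smash (num 2) (num 1)) (Mul w (num 2)).
  apply: nd_eq_trans (nd_smashC _ _) _.
  apply: nd_eq_trans (nd_eq_smash (nd_refl _ _ _)
    (nd_eq_sym (@ev_mul (num 2) (num 1) 2 1 (ev_num _) (ev_num _)))) _.
  apply: nd_eq_trans (@nd_basic 27 [:: num 2; w] G isT).
  exact: nd_andEl (nd_impE (@nd_basic 14 [:: num 1] G isT) (@nd_num_neq0 1 isT)).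
have Hww := nd_eq_trans (nd_eq_sym H2) H2'.
have Hcan u v : (|- Le (Mul w u) (Mul w v)) -> |- Le u v.
  apply: nd_impE; apply: nd_andEl.
  exact: nd_impE (@nd_basic 29 [:: w; u; v] G isT) Hw1.
apply: nd_le_antisym; apply: Hcan; apply: nd_eq_leq => //.
exact: nd_eq_sym.
Qed.

(** Recursion on halves: 1 # 2h and 1 # (2h + 1) both equal 2 (1 # h) for h > 0, which leaves 0 and
    1 as base cases. *)
Lemma ev_smash1 n : ev (Smash (num 1) (num n)) (2 ^ bitlen n).
Proof.
move: {2}n (leqnn n) => k; elim: k n => [|k IH] n.
  rewrite leqn0 => /eqP ->; apply: ev_eq (nd_smashC _ _) _.
  exact: (@nd_basic 13 [:: num 1; num 1] G isT).
case: (leqP n k) => [nk _|kn nk]; first exact: IH.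
have {kn nk}-> : n = k.+1 by lia.
case: k IH => [|k] IH; first exact: ev_smash11.
rewrite bitlen_half // expnS; set h := k.+2./2; have h0 : 0 < h by [].
have Hb := nd_impE (@nd_basic 14 [:: num h] G isT) (nd_num_neq0 h0).
have HI : ev (Mul (num 2) (Smash (num 1) (num h))) (2 * 2 ^ bitlen h).
  by apply/ev_mul/IH; [apply: ev_num|rewrite /h; lia].
have -> : num k.+2 = num (odd k.+2 + h.*2) by rewrite odd_double_half.
case: (odd _); rewrite ?add1n ?add0n.
- apply: ev_eq (nd_eq_smash (nd_refl _ _ _)
    (nd_eq_sym (ev_succ (ev_double _)))) _.
  exact: ev_eq (nd_andEr Hb) HI.
- apply: ev_eq (nd_eq_smash (nd_refl _ _ _) (nd_eq_sym (ev_double _))) _.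
  exact: ev_eq (nd_andEl Hb) HI.
Qed.

(** For a > 0, |a| = |a/2| + |1|, so a # b = (a/2 # b) (1 # b), and a is halved down to 0. *)
Lemma ev_smash t u a b :
  ev t a -> ev u b -> ev (Smash t u) (2 ^ (bitlen a * bitlen b)).
Proof.
move=> Ht Hu; apply: ev_eq (nd_eq_smash Ht Hu) _ => {t u Ht Hu}.
move: {2}a (leqnn a) => k; elim: k a => [|k IH] a.
  by rewrite leqn0 => /eqP ->; exact: (@nd_basic 13 [:: Zero; num b] G isT).
case: (posnP a) => [->|a0] ak.
  exact: (@nd_basic 13 [:: Zero; num b] G isT).
have Hh : ev (Len (num a)) (bitlen a./2).+1.
  by rewrite -bitlen_half //; apply/ev_len/ev_num.
rewrite bitlen_half // mulSnr expnD.
have Hb := @nd_basic 17 [:: num a; num b; num a./2; num 1] G isT.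
apply: ev_eq (nd_impE Hb _) _; last first.
  by apply/ev_mul/ev_smash1/IH; lia.
apply: nd_ev_eq Hh _; rewrite -[(bitlen _).+1]addn1.
by apply: ev_add; [|apply: (@ev_len _ 1)]; [apply: ev_len|]; apply: ev_num.
Qed.

Lemma ev_closed e t : ev (tsubst (fun n => num (e n)) t) (teval e t).
Proof.
elim: t => /= [n||t IH|t IHt u IHu|t IHt u IHu|t IH|t IH|t IHt u IHu].
- exact: ev_num.
- exact: (ev_num 0).
- exact: ev_succ.
- exact: ev_add.
- exact: ev_mul.
- exact: ev_half.
- exact: ev_len.
- exact: ev_smash.
Qed.

End Rules.

Lemma nd_nle_num G a b : b < a -> nd S12 G (Not (Le (num a) (num b))).
Proof.
move=> ba; apply: nd_impI; apply: nd_impE (@nd_neq_num _ a b _) _; first lia.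
apply: nd_le_antisym; [exact: nd_hyp0|apply: nd_le_num; lia].
Qed.

(** Discreteness of the order: if t <= k + 1 and t differs from k + 1, then t <= k. This turns a
    quantifier bounded by a numeral into finitely many cases. *)
Lemma nd_le_num_cases G t k C :
  nd S12 G (Le t (num k)) ->
  (forall i, i <= k -> nd S12 (Eq t (num i) :: G) C) -> nd S12 G C.
Proof.
elim: k G => [|k IH] G Hle HC.
  by apply: nd_cut (HC 0 isT); apply: nd_le_antisym Hle (nd_le0 _ _).
apply: (nd_em (HC k.+1 (leqnn _))).
apply: IH => [|i ik]; last first.
  apply: nd_weak (HC i _); last by lia.
  by move=> B /=; tauto.
apply: nd_orE (nd_le_total _ t (num k)) _ _; last exact: nd_hyp0.
set H := _ :: _ :: G; have Hle' : nd S12 H (Le t (num k.+1)) by do 2 apply: nd_wk.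
apply: (@nd_em _ _ (Eq (num k) t)).
  by apply/nd_eq_leq/nd_eq_sym/nd_hyp0.
apply: nd_absurd (_ : nd S12 _ (Eq t (num k.+1))); first by apply: nd_hyp; rewrite /=; tauto.
apply: nd_le_antisym; first exact: nd_wk.
by apply: nd_lt; apply: nd_hyp; rewrite /=; tauto.
Qed.

(** * Sigma1-completeness on cuts *)

Definition numenv (e : nat -> nat) (n : nat) : term := num (e n).

Lemma inst_numenv e k A :
  inst (num k) (fsubst (up (numenv e)) A) = fsubst (numenv (env_cons k e)) A.
Proof. by rewrite inst_up; apply: fsubst_ext; case. Qed.

Lemma nd_numenv_var0 T G e k A :
  nd T G (Eq (Var 0) (num k)) -> nd T G (fsubst (numenv (env_cons k e)) A) ->
  nd T G (fsubst (up (numenv e)) A).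
Proof.
move=> /nd_eq_sym He; rewrite -inst_numenv => H.
suff <- : inst (Var 0) (fsubst (up (numenv e)) A) = fsubst (up (numenv e)) A.
  exact: nd_leibniz He H.
by rewrite inst_up; apply: fsubst_ext => -[|n] //=; rewrite /tshift tsubst_num.
Qed.

Lemma fsubst_ball e n A : fsubst (numenv e) (ball (Var n) A) =
  All (Imp (Le (Var 0) (num (e n))) (fsubst (up (numenv e)) A)).
Proof. by rewrite /= /tshift tsubst_num. Qed.

Lemma fsubst_bex e n A : fsubst (numenv e) (bex (Var n) A) =
  Ex (And (Le (Var 0) (num (e n))) (fsubst (up (numenv e)) A)).
Proof. by rewrite /= /tshift tsubst_num. Qed.

(** Truth and falsity are treated together because an implication exchanges them. Closed terms
    evaluate to numerals, and bounded quantifiers range over finitely many numerals. *)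
Lemma delta0_decided A e : delta0 A ->
  (sat e A /\ proves S12 (fsubst (numenv e) A)) \/
  (~ sat e A /\ proves S12 (Not (fsubst (numenv e) A))).
Proof.
have evE e' t : nd S12 [::] (Eq (tsubst (numenv e') t) (num (teval e' t))).
  exact: ev_closed.
move=> HA; elim: HA e => {A}.
- by move=> e; right; split=> //; apply/nd_impI/nd_hyp0.
- move=> t u e /=; case: (eqVneq (teval e t) (teval e u)) => H.
    by left; split=> //; apply: nd_ev_eq (evE e t) _; rewrite H; apply: evE.
  right; split; first exact/eqP.
  apply: nd_impI; apply: nd_impE (nd_wk _ (nd_neq_num _ H)) _.
  apply: nd_eq_trans (nd_wk _ (nd_eq_sym (evE e t))) _.
  by apply: nd_eq_trans (nd_wk _ (evE e u)); apply: nd_hyp0.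
- move=> t u e /=; case: (leqP (teval e t) (teval e u)) => H.
    left; split=> //; apply: nd_eq_le (nd_le_num _ H); exact/nd_eq_sym/evE.
  right; split; first by [].
  apply: nd_impI; apply: nd_impE (nd_wk _ (nd_nle_num _ H)) _.
  by apply: nd_eq_le (nd_hyp0 _ _ _); apply/nd_wk/evE.
- move=> A B _ IHA _ IHB e /=; case: (IHB e) => -[hB pB].
    by left; split=> //; apply/nd_impI/nd_wk.
  case: (IHA e) => -[hA pA].
    right; split; first by move=> /(_ hA).
    apply: nd_impI; apply: nd_impE (nd_wk _ pB) _.
    exact: nd_impE (nd_hyp0 _ _ _) (nd_wk _ pA).
  by left; split=> //; apply: nd_impI; apply: nd_absurd (nd_wk _ pA) (nd_hyp0 _ _ _).
- move=> A B _ IHA _ IHB e /=; case: (IHA e) => -[hA pA]; last first.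
    right; split; first by case.
    apply: nd_impI; apply: nd_impE (nd_wk _ pA) _; exact: nd_andEl (nd_hyp0 _ _ _).
  case: (IHB e) => -[hB pB]; first by left; split=> //; apply: nd_andI.
  right; split; first by case.
  apply: nd_impI; apply: nd_impE (nd_wk _ pB) _; exact: nd_andEr (nd_hyp0 _ _ _).
- move=> A B _ IHA _ IHB e /=; case: (IHA e) => -[hA pA].
    by left; split; [left|apply: nd_orIl].
  case: (IHB e) => -[hB pB]; first by left; split; [right|apply: nd_orIr].
  right; split; first by case.
  apply: nd_impI; apply: nd_orE (nd_hyp0 _ _ _) _ _.
    by apply: nd_impE (nd_wk _ (nd_wk _ pA)) (nd_hyp0 _ _ _).
  by apply: nd_impE (nd_wk _ (nd_wk _ pB)) (nd_hyp0 _ _ _).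
- move=> n A _ IH e; rewrite fsubst_ball /=.
  case: (classic (exists2 k, k <= e n & ~ sat (env_cons k e) A)) => [[k kn nA]|HA].
    right; split; first by move=> /(_ k kn).
    case: (IH (env_cons k e)) => [[]//|[_ pA]].
    apply: nd_impI; apply: nd_impE (nd_wk _ pA) _.
    have := nd_allE (num k) (nd_hyp0 S12 [::] (All (Imp (Le (Var 0) (num (e n)))
      (fsubst (up (numenv e)) A)))).
    rewrite -inst_numenv /inst /= tsubst_num => H.
    apply: nd_impE H _; exact: nd_le_num.
  have {}HA k : k <= e n -> sat (env_cons k e) A.
    by move=> kn; apply: NNPP => nA; apply: HA; exists k.
  left; split=> //; apply: nd_allI; apply: nd_impI.
  apply: nd_le_num_cases (nd_hyp0 _ _ _) _ => k /HA sA.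
  apply: nd_numenv_var0 (nd_hyp0 _ _ _) _; apply: nd_proves.
  by case: (IH (env_cons k e)) => -[].
- move=> n A _ IH e; rewrite fsubst_bex /=.
  case: (classic (exists2 k, k <= e n & sat (env_cons k e) A)) => [[k kn sA]|HA].
    left; split; first by exists k.
    case: (IH (env_cons k e)) => [[_ pA]|[]//].
    apply: (@nd_exI _ _ _ (num k)); rewrite /inst /= tsubst_num; apply: nd_andI.
      exact: nd_le_num.
    by rewrite -/(inst _ _) inst_numenv.
  right; split; first by case=> k [kn sA]; apply: HA; exists k.
  apply: nd_impI; apply: nd_exE (nd_hyp0 _ _ _) _.
  apply: nd_le_num_cases (nd_andEl (nd_hyp0 _ _ _)) _ => k kn.
  apply: nd_impE (nd_andEr (nd_hyp1 _ _ _ _)).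
  apply: (@nd_numenv_var0 _ _ _ _ (Not A) (nd_hyp0 _ _ _)); apply: nd_proves.
  case: (IH (env_cons k e)) => -[] // sA.
  by case: HA; exists k.
Qed.

Lemma delta0_complete A e : delta0 A -> sat e A -> proves S12 (fsubst (numenv e) A).
Proof. by move/(delta0_decided e) => [[]|[]]. Qed.

(* Only the outer existential quantifiers are relativised: on cuts, bounded   *)
(* quantifiers need not be.                                                   *)
Definition ex_cut (I : form) (k : nat) (A : form) : form :=
  iter k (fun B => Ex (And I B)) A.

Lemma relativise_iter_ex I k A :
  relativise I (iter k Ex A) = ex_cut I k (relativise I A).
Proof. by elim: k => //= k ->. Qed.

(** The induction is external: n applications of closure under successor. *)
Lemma cut_num I n G : cut I -> nd S12 G (inst (num n) I).
Proof.
case=> _ H0 HS _; elim: n => [|n IH]; first exact: nd_proves.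
have := nd_allE (num n) (nd_proves G HS); rewrite /inst /= => H.
move: (nd_impE H IH); rewrite /repl fsubst_comp.
by congr (nd _ _ _); apply: fsubst_ext => -[].
Qed.

Lemma nd_allE2 T G A t u :
  nd T G (All (All A)) -> nd T G (fsubst (scons u (scons t Var)) A).
Proof. by move=> /(nd_allE t)/(nd_allE u); rewrite -inst_up. Qed.

Lemma cut_down I G t u :
  cut I -> nd S12 G (inst t I) -> nd S12 G (Le u t) -> nd S12 G (inst u I).
Proof.
case=> fvI _ _ HD Ht Hu.
have := nd_allE2 t u (nd_proves G HD).
rewrite /= !(fsubst_inst1 _ _ fvI) /= => H.
by apply: nd_impE H _; apply: nd_andI.
Qed.

Lemma subcut_nd I J G t : subcut I J -> nd S12 G (inst t I) -> nd S12 G (inst t J).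
Proof. by move=> /(nd_proves G)/(nd_allE t); apply: nd_impE. Qed.

Lemma delta0_ex_cut_complete I k A e : cut I -> delta0 A -> sat e (iter k Ex A) ->
  proves S12 (fsubst (numenv e) (ex_cut I k A)).
Proof.
move=> HI HA; elim: k e => [|k IH] e /=; first exact: delta0_complete.
case=> a /IH H; apply: (@nd_exI _ _ _ (num a)).
rewrite -[And _ _]/(fsubst (up (numenv e)) (And I (ex_cut I k A))) inst_numenv /=.
apply: nd_andI => //; rewrite fsubst_fv1; last by case: HI.
exact: cut_num.
Qed.

Lemma inst_var0_up A : inst (Var 0) (fsubst (up (fun n => Var n.+1)) A) = A.
Proof. by rewrite inst_up -[RHS]fsubst_id; apply: fsubst_ext; case. Qed.

Lemma nd_all_mono T G A B :
  nd T (A :: map fshift G) B -> nd T (All A :: G) (All B).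
Proof.
move=> H; apply: nd_allI; apply: (@nd_cut _ _ A).
  by have := nd_allE (Var 0) (nd_hyp0 T (map fshift G) (fshift (All A)));
     rewrite inst_var0_up.
by apply: nd_weak H => C /=; tauto.
Qed.

Lemma nd_ex_mono T G A B :
  nd T (A :: map fshift G) B -> nd T (Ex A :: G) (Ex B).
Proof.
move=> H; apply: nd_exE (nd_hyp0 _ _ _) _.
apply: (@nd_exI _ _ _ (Var 0)); rewrite inst_var0_up.
by apply: nd_weak H => C /=; tauto.
Qed.

Lemma ex_cut_mono I J k A G :
  fv I <= 1 -> fv J <= 1 -> subcut I J ->
  nd S12 G (ex_cut I k A) -> nd S12 G (ex_cut J k A).
Proof.
move=> fvI fvJ HIJ; elim: k G => [|k IH] G //= H.
apply: nd_cut H _; apply: nd_ex_mono.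
apply: nd_andI; last exact: IH (nd_andEr (nd_hyp0 _ _ _)).
rewrite -(inst_var0 fvJ); apply: subcut_nd HIJ _; rewrite (inst_var0 fvI).
exact: nd_andEl (nd_hyp0 _ _ _).
Qed.

Lemma nd_iffl T G A B : nd T G (Iff A B) -> nd T G A -> nd T G B.
Proof. by move/nd_andEl; apply: nd_impE. Qed.

Lemma nd_iffr T G A B : nd T G (Iff A B) -> nd T G B -> nd T G A.
Proof. by move/nd_andEr; apply: nd_impE. Qed.

Lemma nd_iffI T G A B : nd T (A :: G) B -> nd T (B :: G) A -> nd T G (Iff A B).
Proof. by move=> H H'; apply: nd_andI; apply: nd_impI. Qed.

(** Bounds are variables, so they lie in the cut only under this assumption on the free
    variables. *)
Definition vars_in (I : form) (n : nat) (G : seq form) : Prop :=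
  forall j, j < n -> List.In (inst (Var j) I) G.

Lemma vars_in_shift I n G G' : fv I <= 1 -> vars_in I n.-1 G -> List.In I G' ->
  (forall B, List.In B (map fshift G) -> List.In B G') -> vars_in I n G'.
Proof.
move=> fvI H HI HG [|j] jn; first by rewrite inst_var0.
rewrite -[Var j.+1]/(tsubst (fun n => Var n.+1) (Var j)).
by rewrite -(fsubst_inst1 _ _ fvI); apply/HG/In_map/H; lia.
Qed.

Lemma vars_in_le I m n G : m <= n -> vars_in I n G -> vars_in I m G.
Proof. by move=> mn H j jm; apply/H/(leq_trans jm). Qed.

(** A bounded variable lies below a variable that is in the cut, hence in the cut by downward
    closure; the added condition [I] is thus automatic. *)
Lemma delta0_relativise I A G : cut I -> delta0 A -> vars_in I (fv A) G ->
  nd S12 G (Iff (relativise I A) A).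
Proof.
move=> HI; have fvI : fv I <= 1 by case: HI.
have bound n H B : vars_in I n.+1 H -> (forall C, List.In C (map fshift H) -> List.In C B) ->
    nd S12 B (Le (Var 0) (Var n.+1)) -> nd S12 B I.
  move=> HV HB Hle; rewrite -[I](inst_var0 fvI); apply: cut_down HI _ Hle.
  apply/nd_hyp/HB; rewrite -[Var n.+1]/(tsubst (fun n => Var n.+1) (Var n)).
  by rewrite -(fsubst_inst1 _ _ fvI); apply/In_map/HV.
move=> HA; elim: HA G => {A} /=.
- by move=> G _; apply: nd_iffI; apply: nd_hyp0.
- by move=> t u G _; apply: nd_iffI; apply: nd_hyp0.
- by move=> t u G _; apply: nd_iffI; apply: nd_hyp0.
- move=> A B _ IHA _ IHB G HG.
  have {}IHA := IHA G (vars_in_le (leq_maxl _ _) HG).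
  have {}IHB := IHB G (vars_in_le (leq_maxr _ _) HG).
  apply: nd_iffI; apply: nd_impI.
  + apply: nd_iffl (nd_wk _ (nd_wk _ IHB)) _; apply: nd_impE (nd_hyp1 _ _ _ _) _.
    exact: nd_iffr (nd_wk _ (nd_wk _ IHA)) (nd_hyp0 _ _ _).
  + apply: nd_iffr (nd_wk _ (nd_wk _ IHB)) _; apply: nd_impE (nd_hyp1 _ _ _ _) _.
    exact: nd_iffl (nd_wk _ (nd_wk _ IHA)) (nd_hyp0 _ _ _).
- move=> A B _ IHA _ IHB G HG.
  have {}IHA := IHA G (vars_in_le (leq_maxl _ _) HG).
  have {}IHB := IHB G (vars_in_le (leq_maxr _ _) HG).
  apply: nd_iffI; apply: nd_andI.
  + exact: nd_iffl (nd_wk _ IHA) (nd_andEl (nd_hyp0 _ _ _)).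
  + exact: nd_iffl (nd_wk _ IHB) (nd_andEr (nd_hyp0 _ _ _)).
  + exact: nd_iffr (nd_wk _ IHA) (nd_andEl (nd_hyp0 _ _ _)).
  + exact: nd_iffr (nd_wk _ IHB) (nd_andEr (nd_hyp0 _ _ _)).
- move=> A B _ IHA _ IHB G HG.
  have {}IHA := IHA G (vars_in_le (leq_maxl _ _) HG).
  have {}IHB := IHB G (vars_in_le (leq_maxr _ _) HG).
  apply: nd_iffI; apply: nd_orE (nd_hyp0 _ _ _) _ _.
  + exact/nd_orIl/(nd_iffl (nd_wk _ (nd_wk _ IHA)))/nd_hyp0.
  + exact/nd_orIr/(nd_iffl (nd_wk _ (nd_wk _ IHB)))/nd_hyp0.
  + exact/nd_orIl/(nd_iffr (nd_wk _ (nd_wk _ IHA)))/nd_hyp0.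
  + exact/nd_orIr/(nd_iffr (nd_wk _ (nd_wk _ IHB)))/nd_hyp0.
- move=> n A _ IH G HG; rewrite -[tshift _]/(Var n.+1); set L := Le _ _.
  have HV : vars_in I n.+1 G by apply: vars_in_le HG; lia.
  have HI' H : nd S12 [:: L, H & map fshift G] I.
    by apply: bound HV _ (nd_hyp0 _ _ _) => C /=; tauto.
  have {}IH H : nd S12 [:: I, L, H & map fshift G] (Iff (relativise I A) A).
    apply: IH; apply: (@vars_in_shift _ _ G) => //=; last by tauto.
      by apply: vars_in_le HG; lia.
    by left.
  apply: nd_iffI; apply: nd_all_mono.
  + apply: nd_impI; apply: nd_cut (HI' _) _; apply: nd_iffl (IH _) _.
    apply: (@nd_impE _ _ L); last exact: nd_hyp1.
    by apply: (@nd_impE _ _ I); apply: nd_hyp; rewrite /=; tauto.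
  + do 2 apply: nd_impI.
    apply: (@nd_weak _ [:: I, L, Imp L A & map fshift G]).
      by move=> C /=; tauto.
    apply: nd_iffr (IH _) _.
    by apply: (@nd_impE _ _ L); apply: nd_hyp; rewrite /=; tauto.
- move=> n A _ IH G HG; rewrite -[tshift _]/(Var n.+1); set L := Le _ _.
  have HV : vars_in I n.+1 G by apply: vars_in_le HG; lia.
  have {}IH H : nd S12 [:: I, H & map fshift G] (Iff (relativise I A) A).
    apply: IH; apply: (@vars_in_shift _ _ G) => //=; last by tauto.
      by apply: vars_in_le HG; lia.
    by left.
  apply: nd_iffI; apply: nd_ex_mono.
  + set H := And I _; have HH := nd_hyp0 S12 (map fshift G) H.
    apply: nd_andI; first exact: nd_andEl (nd_andEr HH).
    apply: nd_cut (nd_andEl HH) _; apply: nd_iffl (IH _) _.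
    exact/nd_wk/nd_andEr/(nd_andEr HH).
  + pose H := And L A; have HH := nd_hyp0 S12 (map fshift G) H.
    have HIH : nd S12 (H :: map fshift G) I.
      by apply: bound HV _ (nd_andEl HH) => C /=; tauto.
    apply: nd_andI => //; apply: nd_andI; first exact: nd_andEl HH.
    apply: nd_cut HIH _; apply: nd_iffr (IH _) _.
    exact/nd_wk/(nd_andEr HH).
Qed.

Lemma relativise_ex_cut I k A G : cut I -> delta0 A ->
  vars_in I (fv (iter k Ex A)) G ->
  nd S12 G (Iff (relativise I (iter k Ex A)) (ex_cut I k A)).
Proof.
move=> HI HA; have fvI : fv I <= 1 by case: HI.
elim: k G => [|k IH] G HG; first exact: delta0_relativise.
have {}IH H : nd S12 [:: I, H & map fshift G]
    (Iff (relativise I (iter k Ex A)) (ex_cut I k A)).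
  apply: IH; apply: (@vars_in_shift _ _ G) => //=; last by tauto.
  by left.
apply: nd_iffI; apply: nd_ex_mono; set H := And I _;
  have HH := nd_hyp0 S12 (map fshift G) H; apply: nd_andI;
  try exact: nd_andEl HH; apply: nd_cut (nd_andEl HH) _.
- exact: nd_iffl (IH _) (nd_wk _ (nd_andEr HH)).
- exact: nd_iffr (IH _) (nd_wk _ (nd_andEr HH)).
Qed.

Lemma sigma1_iter_ex A : sigma1 A -> exists k B, delta0 B /\ A = iter k Ex B.
Proof.
elim=> {A} [A HA|A _ [k [B [HB ->]]]]; first by exists 0, A.
by exists k.+1, B.
Qed.

Lemma sentence_relativise_ex_cut I k A G :
  cut I -> delta0 A -> sentence (iter k Ex A) ->
  nd S12 G (Iff (relativise I (iter k Ex A)) (ex_cut I k A)).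
Proof. by move=> HI HA HS; apply: relativise_ex_cut => // j; rewrite HS. Qed.

Lemma fv_ex_cut I k A : fv I <= 1 -> fv (ex_cut I k A) = fv (iter k Ex A).
Proof. by move=> HI; elim: k => //= k ->; lia. Qed.

Lemma sentence_relativise I A : fv I <= 1 -> sentence A -> sentence (relativise I A).
Proof.
rewrite /sentence => HI HA; suff : fv (relativise I A) <= fv A by rewrite HA; lia.
elim: A {HA} => //= *; lia.
Qed.

(** Standard witnesses have numerals, which S12 puts into every cut, and the Delta_0-matrix is then
    provable. *)
Lemma sigma1_cut_complete I A : cut I -> sigma1_sentence A -> true_sentence A ->
  proves S12 (relativise I A).
Proof.
move=> HI [/sigma1_iter_ex[k [B [HB ->]]] HS] HT.
apply: nd_iffr (sentence_relativise_ex_cut _ HI HB HS) _.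
have <- := @sentence_fsubst (ex_cut I k B) (numenv (fun=> 0)) _.
  exact: delta0_ex_cut_complete.
by rewrite /sentence fv_ex_cut //; case: HI.
Qed.

(** Witnesses in the smaller cut lie in the larger one, and the matrix does not depend on the
    cut. *)
Lemma relativise_mono I J A G : cut I -> cut J -> subcut I J -> sigma1_sentence A ->
  nd S12 G (relativise I A) -> nd S12 G (relativise J A).
Proof.
move=> HI HJ HIJ [/sigma1_iter_ex[k [B [HB ->]]] HS] D.
apply: nd_iffr (sentence_relativise_ex_cut _ HJ HB HS) _.
apply: (@ex_cut_mono I); [by case: HI|by case: HJ|by []|].
exact: nd_iffl (sentence_relativise_ex_cut _ HI HB HS) D.
Qed.

(** * Complexity *)

Lemma alternations_le_rho q A : alternations q A <= rho A.
Proof.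
by rewrite /rho; elim: A q => //= [A IHA B IHB|A IHA B IHB|A IHA B IHB|A _|A _] q;
  rewrite ?leq_add2r ?leq_b1 // geq_max !leq_max ?IHA ?IHB ?orbT.
Qed.

Lemma alternations_iter_ex k A :
  alternations (Some true) (iter k Ex A) = alternations (Some true) A.
Proof. by elim: k. Qed.

Lemma rho_iter_ex k A : 0 < k -> rho (iter k Ex A) = (alternations (Some true) A).+1.
Proof. by case: k => // k _; rewrite /rho /= alternations_iter_ex. Qed.

(** All copies of [I] sit directly under one existential block, so the complexities combine by a
    maximum. Full relativisation would also place copies below the alternations of [A]. *)
Lemma rho_ex_cut I k A : rho (ex_cut I k A) <= maxn (rho (iter k Ex A)) (rho I + 1).
Proof.
case: k => [|k]; first exact: leq_maxl.
rewrite rho_iter_ex // /rho /=.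
have H : alternations (Some true) (ex_cut I k A)
    <= maxn (alternations (Some true) I) (alternations (Some true) A).
  by elim: k => [|k IH] /=; lia.
by have := alternations_le_rho (Some true) I; rewrite /rho; lia.
Qed.

(** * Diagonalisation *)

(** The number of binary digits of the code of [s]; concatenating sequences concatenates binary
    expansions. *)
Definition weight (s : seq nat) : nat := sumn (map S s).

Lemma code_cons n s : CodeSeq.code (n :: s) = 2 ^ n * (2 * CodeSeq.code s).+1.
Proof. by rewrite mul2n. Qed.

Lemma code_cat s s' :
  CodeSeq.code (s ++ s') = CodeSeq.code s + 2 ^ weight s * CodeSeq.code s'.
Proof.
elim: s => [|n s IH]; first by rewrite mul1n.
rewrite cat_cons !code_cons IH /weight /= addSn expnS expnD.
by move: (2 ^ n) (2 ^ _) (CodeSeq.code s) (CodeSeq.code s') => a b c d; nia.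
Qed.

(* A closed term for 2 ^ n whose Polish notation is an n-fold repetition of   *)
(* one block: summing the geometric series, its code is a rational function   *)
(* of 2 ^ n, which is how the language can refer to it.                       *)
Definition exp2_term (n : nat) : term := iter n (Mul (num 2)) (num 1).

Definition block : seq nat := 3 :: ttokens (num 2).

Lemma teval_exp2_term e n : teval e (exp2_term n) = 2 ^ n.
Proof. by elim: n => //= n ->; rewrite expnS. Qed.

Lemma tfv_exp2_term n : tfv (exp2_term n) = 0.
Proof. by elim: n => // n /= ->. Qed.

(** The sum of the geometric series given by n blocks, cleared of the denominator 2 ^ [weight block]
    - 1 and of the negative term. *)
Lemma code_exp2_term n s (r := ttokens (num 1) ++ s) :
  (2 ^ weight block - 1) * CodeSeq.code (ttokens (exp2_term n) ++ s)
    + CodeSeq.code block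
  = (2 ^ n) ^ weight block *
    (CodeSeq.code block + (2 ^ weight block - 1) * CodeSeq.code r).
Proof.
elim: n => [|n IH]; first by rewrite expn0 exp1n mul1n [LHS]addnC.
have -> : ttokens (exp2_term n.+1) ++ s = block ++ ttokens (exp2_term n) ++ s.
  by [].
rewrite code_cat expnS expnMn -mulnA -IH.
have : 0 < 2 ^ weight block by rewrite expn_gt0.
move: (2 ^ _) (CodeSeq.code _) (CodeSeq.code _) => a b c a0.
by case: a a0 => // a _; rewrite subn1 /=; nia.
Qed.

Definition pow_term (k : nat) (t : term) : term := iter k (Mul t) (num 1).

Lemma teval_pow_term e k t : teval e (pow_term k t) = teval e t ^ k.
Proof. by elim: k => //= k ->; rewrite expnS. Qed.

Lemma tfv_pow_term k t : tfv (pow_term k t) <= tfv t.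
Proof. by elim: k => //= k IH; rewrite geq_max leqnn. Qed.

(** The identity of [code_exp2_term] with a prefix put in front: [D], [B], [W] belong to the block,
    [a], [b] to the final numeral 1, [c], [P] to the prefix. Being one equation, it adds no
    quantifier to the diagonal sentence. *)
Definition series_eq (D B W a b c P : nat) (x y : term) : form :=
  Eq (Add (Mul (num D) y) (Mul (num P) (num B)))
     (Add (Mul (num D) (num c))
          (Mul (num P) (Mul (pow_term W x)
             (Add (num B)
                (Mul (num D) (Add (num a) (Mul (num b) (Len (Half x))))))))).

Lemma sat_series_eq e D B W a b c P x y :
  sat e (series_eq D B W a b c P x y) <->
  D * teval e y + P * B =
  D * c + P * (teval e x ^ W * (B + D * (a + b * bitlen (teval e x)./2))).
Proof. by rewrite /= !teval_num teval_pow_term. Qed.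

Lemma fv_series_eq D B W a b c P x y :
  fv (series_eq D B W a b c P x y) <= maxn (tfv x) (tfv y).
Proof. by rewrite /= !tfv_num; have := tfv_pow_term W x; lia. Qed.

(* With c and P the code and 2 ^ weight of p, and x = 2 ^ code s, this states *)
(* that y is the code of p ++ ttokens (exp2_term (code s)) ++ s: note that    *)
(* |x / 2| = code s.                                                          *)
Definition code_eq (c P : nat) : term -> term -> form :=
  series_eq (2 ^ weight block - 1) (CodeSeq.code block) (weight block)
    (CodeSeq.code (ttokens (num 1))) (2 ^ weight (ttokens (num 1))) c P.

Lemma fv_code_eq c P x y : fv (code_eq c P x y) <= maxn (tfv x) (tfv y).
Proof. exact: fv_series_eq. Qed.

Lemma sat_code_eq e p s x y : teval e x = 2 ^ CodeSeq.code s ->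
  sat e (code_eq (CodeSeq.code p) (2 ^ weight p) x y) <->
  teval e y = CodeSeq.code (p ++ ttokens (exp2_term (CodeSeq.code s)) ++ s).
Proof.
move=> Hx; have Hh : bitlen (teval e x)./2 = CodeSeq.code s.
  have := bitlen_exp2 (CodeSeq.code s); rewrite -Hx bitlen_half; first by case.
  by rewrite Hx expn_gt0.
rewrite sat_series_eq Hh Hx -code_cat.
rewrite -code_exp2_term (code_cat p).
have : 0 < 2 ^ weight block - 1 by rewrite subn_gt0 -{1}(expn0 2) ltn_exp2l.
move: (2 ^ weight block - 1) (2 ^ weight p) => D P D0.
move: (CodeSeq.code _) (CodeSeq.code _) (CodeSeq.code _) => c B q.
split=> [H|->]; last by nia.
by apply/eqP; rewrite -(eqn_pmul2l D0); apply/eqP; nia.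
Qed.

Lemma sat_iter_ex_and k e C A Q :
  (forall e', (forall j, e' (j + k) = e j) -> sat e' C <-> Q) ->
  sat e (iter k Ex (And C A)) <-> Q /\ sat e (iter k Ex A).
Proof.
elim: k e => [|k IH] e HC /=; first by rewrite (HC e) // => j; rewrite addn0.
have {}IH a : sat (env_cons a e) (iter k Ex (And C A)) <->
    Q /\ sat (env_cons a e) (iter k Ex A).
  by apply: IH => e' He'; apply: HC => j; rewrite addnS -addSn He'.
split=> [[a /IH[HQ Ha]]|[HQ [a Ha]]]; first by split=> //; exists a.
by exists a; apply/IH.
Qed.

Lemma fv_iter_ex k A : fv (iter k Ex A) = fv A - k.
Proof. by elim: k => [|k IH] /=; rewrite ?IH; lia. Qed.

Lemma ftokens_ex_cut I k A :
  ftokens (ex_cut I k A) = flatten (nseq k [:: 14, 11 & ftokens I]) ++ ftokens A.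
Proof. by elim: k => //= k ->; rewrite catA. Qed.

(** Under the k quantifiers of the provability predicate, [Var k] is its argument y, and [Var k.+1]
    is the variable x that holds 2 ^ code s. *)
Definition diag_matrix (k : nat) (A : form) (p : seq nat) : form :=
  And (code_eq (CodeSeq.code p) (2 ^ weight p) (Var k.+1) (Var k)) A.

Lemma sentence_diag k A p n : fv (iter k Ex A) <= 1 ->
  sentence (iter k.+2 Ex (And (Eq (Var k.+1) (exp2_term n)) (diag_matrix k A p))).
Proof.
rewrite /sentence !fv_iter_ex /diag_matrix.
have := fv_code_eq (CodeSeq.code p) (2 ^ weight p) (Var k.+1) (Var k).
by move: (code_eq _ _ _ _) => E /=; rewrite tfv_exp2_term; lia.
Qed.

Lemma sat_diag k A p s : fv (iter k Ex A) <= 1 ->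
  true_sentence (iter k.+2 Ex (And (Eq (Var k.+1) (exp2_term (CodeSeq.code s)))
                                   (diag_matrix k A p))) <->
  sat (fun=> CodeSeq.code (p ++ ttokens (exp2_term (CodeSeq.code s)) ++ s))
      (iter k Ex A).
Proof.
move=> fvA; set y0 := CodeSeq.code (p ++ _); set x0 := 2 ^ CodeSeq.code s.
have H e x y : sat (env_cons y (env_cons x e)) (iter k Ex
    (And (Eq (Var k.+1) (exp2_term (CodeSeq.code s))) (diag_matrix k A p))) <->
    x = x0 /\ y = y0 /\ sat (fun=> y) (iter k Ex A).
  rewrite (@sat_iter_ex_and _ _ _ _ (x = x0)); last first.
    by move=> e' He'; rewrite /= teval_exp2_term -[x]/(env_cons y (env_cons x e) 1) -He'.
  have HE : x = x0 -> sat (env_cons y (env_cons x e)) (iter k Ex (diag_matrix k A p)) <->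
      y = y0 /\ sat (env_cons y (env_cons x e)) (iter k Ex A).
    move=> Hx; apply: sat_iter_ex_and => e' He'.
    have Hx' : e' k.+1 = x := He' 1; have Hy' : e' k = y := He' 0.
    by rewrite -Hy'; apply: sat_code_eq; rewrite -/x0 -Hx -Hx'.
  have -> : sat (fun=> y) (iter k Ex A) <->
      sat (env_cons y (env_cons x e)) (iter k Ex A).
    by apply: sat_eq_fv => -[|j] //; lia.
  by split=> -[Hx HM]; split=> //; apply/(HE Hx).
rewrite /true_sentence /=; split=> [[x [y /H [_ [->]]]]|Hy] //.
by exists x0, y0; apply/H.
Qed.

Lemma sigma1_iter_ex_delta0 k A : delta0 A -> sigma1 (iter k Ex A).
Proof. by move=> HA; elim: k => [|k IH]; constructor. Qed.

(** The Polish notation of ~ (Phi /\ S^I) up to the place where S mentions its closed term; each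
    relativised quantifier contributes 14, 11 and [I]. *)
Definition diag_prefix (I Phi : form) (k : nat) : seq nat :=
  [:: 10; 11] ++ ftokens Phi ++ flatten (nseq k.+2 [:: 14, 11 & ftokens I])
    ++ [:: 11; 8; 15 + k.+1].

Lemma ftokens_diag I Phi k t B :
  ftokens (Not (And Phi (relativise I (iter k.+2 Ex (And (Eq (Var k.+1) t) B)))))
  = diag_prefix I Phi k ++ ttokens t ++ (ftokens (relativise I B) ++ [:: 7]).
Proof.
rewrite relativise_iter_ex [LHS]/= ftokens_ex_cut /=.
by do 4?rewrite -!catA /=.
Qed.

(** S is true iff S12 proves ~ (Phi /\ S^I). If S were true, that theorem would be true, although
    Phi holds and so does S^I, since cuts contain all standard numbers. So S is false, and there is
    no such proof. *)
Lemma diagonal prov Phi I : provability_predicate prov ->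
  sentence Phi -> true_sentence Phi -> cut I ->
  exists S, [/\ sigma1_sentence S, ~ true_sentence S, rho S <= rho prov + 1
              & ~ proves S12 (Not (And Phi (relativise I S)))].
Proof.
case=> /sigma1_iter_ex[k [A [HA ->]]] fvA Hprov sPhi tPhi HI.
have fvI : fv I <= 1 by case: HI.
have [S [sS S1 rS HS]] : exists S, [/\ sentence S, sigma1 S,
    rho S <= rho (iter k Ex A) + 1 & true_sentence S <->
    sat (fun=> code (Not (And Phi (relativise I S)))) (iter k Ex A)].
  pose p := diag_prefix I Phi k.
  (* [p] and [s] are the parts before and after the closed term. Neither contains it, so the term
     can be chosen to name [s] without circularity. *)
  pose s := ftokens (relativise I (diag_matrix k A p)) ++ [:: 7].
  exists (iter k.+2 Ex (And (Eq (Var k.+1) (exp2_term (CodeSeq.code s)))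
                            (diag_matrix k A p))); split.
  - exact: sentence_diag.
  - by apply: sigma1_iter_ex_delta0; do 3 constructor => //.
  - rewrite rho_iter_ex // -addn1 leq_add2r [leqLHS]/=.
    have := alternations_le_rho (Some true) (iter k Ex A).
    by rewrite alternations_iter_ex !max0n.
  - by rewrite /code ftokens_diag; apply: sat_diag.
have sX : sentence (Not (And Phi (relativise I S))).
  by rewrite /sentence /= (sentence_relativise fvI sS) sPhi.
have {}HS : true_sentence S <-> proves S12 (Not (And Phi (relativise I S))).
  by rewrite HS; apply: Hprov.
have nS : ~ true_sentence S.
  move=> tS; have /HS/(@proves_S12_sound _ (fun=> 0)) := tS.
  by apply; split=> //; apply/sat_relativise.
by exists S; split=> //; rewrite -HS.
Qed.

(** * Finite theories *)

Fixpoint const_rec (a : nat) : recf :=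
  if a is a'.+1 then RComp RSucc [:: const_rec a'] else RZero.

Lemma eval_const_rec a v : eval (const_rec a) v a.
Proof.
elim: a => [|a IH] /=; first exact: eval_zero.
apply: (@eval_comp _ _ _ [:: a]); last exact: eval_succ.
by apply: evals_cons IH _; apply: evals_nil.
Qed.

Lemma eval_const_rec_inv a v n : eval (const_rec a) v n -> n = a.
Proof.
elim: a n => [|a IH] n /= H; inversion H; subst=> //.
match goal with H : evals _ _ _ |- _ => inversion H; subst end.
match goal with H : eval RSucc _ _ |- _ => inversion H; subst end.
by congr S; apply: IH.
Qed.

(** Argument 0 gives the head and k + 1 passes k on to the tail; past the end the last entry
    repeats. *)
Fixpoint list_rec (a : nat) (s : seq nat) : recf :=
  if s is b :: s' then RPrim (const_rec a) (RComp (list_rec b s') [:: RProj 0])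
  else const_rec a.

Lemma eval_list_rec_step a b s k m n :
  eval (list_rec a (b :: s)) [:: k] m -> eval (list_rec b s) [:: k] n ->
  eval (list_rec a (b :: s)) [:: k.+1] n.
Proof.
move=> Hm Hn; apply: eval_primS Hm _; apply: (@eval_comp _ _ _ [:: k]) Hn.
apply: evals_cons; last exact: evals_nil.
by apply: (@eval_proj 0 [:: k; m]).
Qed.

Lemma list_rec_total a s k : exists n, eval (list_rec a s) [:: k] n.
Proof.
elim: s a k => [|b s IH] a k; first by exists a; apply: eval_const_rec.
elim: k => [|k [m Hm]]; first by exists a; apply/eval_prim0/eval_const_rec.
by have [n Hn] := IH b k; exists n; apply: eval_list_rec_step Hm Hn.
Qed.

Lemma rec_enumerable_list a s : rec_enumerable (fun n => List.In n (a :: s)).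
Proof.
exists (list_rec a s) => n; split=> [|[k]].
- elim: s a => [|b s IH] a [->|] //; first by exists 0; apply: eval_const_rec.
    by exists 0; apply/eval_prim0/eval_const_rec.
  move=> /IH[k Hk]; exists k.+1.
  by have [m Hm] := list_rec_total a (b :: s) k; apply: eval_list_rec_step Hm Hk.
- elim: s a k => [|b s IH] a k; first by move/eval_const_rec_inv; left.
  move=> /= H; inversion H; subst; first by left; rewrite (@eval_const_rec_inv a [::] n).
  match goal with H : eval (RComp _ _) _ _ |- _ => inversion H; subst end.
  match goal with H : evals _ _ _ |- _ => inversion H; subst end.
  match goal with H : evals [::] _ _ |- _ => inversion H; subst end.
  match goal with H : eval (RProj _) _ _ |- _ => inversion H; subst end.
  by right; apply: IH; eassumption.
Qed.

Lemma re_theory_list A L : re_theory (fun B => List.In B (A :: L)).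
Proof.
have [f Hf] := rec_enumerable_list (code A) (map code L).
exists f => n; rewrite -Hf -[code A :: _]/(map code (A :: L)).
split=> [[B HB <-]|HB]; first exact: In_map.
by have [B HB' ->] := In_mapE HB; exists B.
Qed.

Lemma same_theorems_add T T' E :
  same_theorems T T' -> same_theorems (theory_add T E) (theory_add T' E).
Proof.
move=> H A; split; apply: nd_theory => B [TB|EB]; try by apply: nd_ax; right.
- by apply: (@nd_sub T'); [left|apply/H/nd_ax].
- by apply: (@nd_sub T); [left|apply/H/nd_ax].
Qed.

Definition finite_theory (E : theory) : Prop :=
  exists L, forall A, E A <-> List.In A L.

(** Replacing the PIND scheme by [axs] makes the theory a finite list, hence recursively enumerable;
    [B] is the head that a nonempty list needs. *)
Lemma finite_extension axs E m B : finite_axiomatisation S12 axs ->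
  finite_theory E -> E B -> (forall A, E A -> sentence A /\ rho A <= m) ->
  exists T, [/\ extension_of_complexity m T, re_theory T
              & same_theorems T (theory_add S12 E)].
Proof.
case=> sax Hax [L HL] EB HE; pose T A := List.In A (B :: axs ++ L).
have HT : same_theorems T (theory_add S12 E).
  move=> A; rewrite -(same_theorems_add E Hax A).
  split; apply: nd_sub => C; rewrite /T /theory_add /= List.in_app_iff -HL.
    by move=> [<-|]; [right|].
  by right.
exists T; split=> //; last exact: re_theory_list.
split; last by exists E.
move=> A; rewrite /T /= List.in_app_iff -HL => -[<-|[/sax//|/HE[]//]].
by case: (HE _ EB).
Qed.

(** * Relativising only the leading existential quantifiers *)

Fixpoint ex_relativise (I A : form) : form :=
  if A is Ex B then Ex (And I (ex_relativise I B)) else A.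

Lemma sigma1_ex_relativise A : sigma1 A -> exists k B,
  [/\ delta0 B, A = iter k Ex B & forall I, ex_relativise I A = ex_cut I k B].
Proof.
elim=> {A} [A HA|A _ [k [B [HB -> HI]]]]; last first.
  by exists k.+1, B; split=> //= I; rewrite HI.
case: HA => [||||||n B HB|n B HB];
  try by intros; eexists 0, _; split; last (by []); constructor.
(* A leading bounded existential quantifier is also an [Ex], so it is relativised too and its bound
   joins the matrix. *)
by exists 1, (And (Le (Var 0) (tshift (Var n))) B); split=> //; apply: d0_and HB; apply: d0_le.
Qed.

Lemma nd_ex_relativise I A G : cut I -> sigma1_sentence A ->
  nd S12 G (Iff (relativise I A) (ex_relativise I A)).
Proof.
move=> HI [/sigma1_ex_relativise[k [B [HB -> ->]]]] HS.
exact: sentence_relativise_ex_cut.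
Qed.

Lemma sentence_ex_relativise I A : cut I -> sigma1_sentence A ->
  sentence (ex_relativise I A).
Proof.
move=> [fvI _ _ _] [/sigma1_ex_relativise[k [B [HB -> ->]]]].
by rewrite /sentence fv_ex_cut.
Qed.

Lemma rho_ex_relativise I A : sigma1 A ->
  rho (ex_relativise I A) <= maxn (rho A) (rho I + 1).
Proof. move=> /sigma1_ex_relativise[k [B [HB -> ->]]]; exact: rho_ex_cut. Qed.

Lemma nd_cut_list T L G A : (forall B, List.In B L -> nd T G B) ->
  nd T (L ++ G) A -> nd T G A.
Proof.
elim: L A => //= B L IH A HL /nd_impI H.
apply: nd_impE (HL B _); last by left.
by apply: IH H => C HC; apply: HL; right.
Qed.

Lemma nd_conj T G L B : List.In B L -> nd T G (foldr And (Not Bot) L) -> nd T G B.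
Proof.
elim: L => //= C L IH [<-|/IH H] D; first exact: nd_andEl D.
by apply: H; apply: nd_andEr D.
Qed.

(** * Consistency of the stages *)

Section Construction.

Variables (axs : seq form) (prov : form) (Sent I : nat -> form) (m : nat -> nat).
Hypothesis Haxs : finite_axiomatisation S12 axs.
Hypothesis Hprov : provability_predicate prov.
Hypothesis HSent : forall n, sigma1_sentence (Sent n).
Hypothesis Hm : forall n,
  m n = maxn (rho_axioms axs)
          (maxn (rho prov + rho (I n) + 1) (\max_(i < n.+1) rho (Sent i))).
Hypothesis HI : forall n, cut (I n).
Hypothesis HIsound : forall n (T : theory),
  extension_of_complexity (m n) T -> re_theory T -> consistent T ->
  sigma1_sound_on (I n.+1) T.

Lemma m_prov n : rho prov + rho (I n) + 1 <= m n.
Proof. by rewrite Hm; lia. Qed.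

Lemma m_Sent k n : k <= n -> rho (Sent k) <= m n.
Proof.
move=> kn; have := @leq_bigmax _ (fun i : 'I_n.+1 => rho (Sent i)) (@Ordinal n.+1 k kn).
by rewrite Hm /=; lia.
Qed.

Lemma finite_sound n E B : finite_theory E -> E B ->
  (forall A, E A -> sentence A /\ rho A <= m n) ->
  consistent (theory_add S12 E) -> sigma1_sound_on (I n.+1) (theory_add S12 E).
Proof.
move=> finE EB HE HC.
have [T [HT reT eqT]] := finite_extension Haxs finE EB HE.
move=> A HA /eqT; apply: (HIsound HT reT) => //.
by rewrite /consistent eqT.
Qed.

(** Otherwise S12 + S^{I_{n+1}}, for the diagonal S with a trivial side condition, would be a
    consistent theory of complexity at most [m n] proving a false sentence on [I n.+1]. *)
Lemma m_le_rho n : m n <= rho (I n.+1).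
Proof.
rewrite leqNgt; apply/negP => Hlt.
have [S [[S1 sS] nS rS nP]] := @diagonal prov (Not Bot) (I n.+1) Hprov erefl id (HI _).
pose C := ex_relativise (I n.+1) S.
have HC G := @nd_ex_relativise (I n.+1) S G (HI _) (conj S1 sS).
apply: nS; apply: (@finite_sound n (eq C) C) => //.
- by exists [:: C] => A /=; split=> [->|[]] //; left.
- move=> _ <-; split; first exact: sentence_ex_relativise.
  by have := rho_ex_relativise (I n.+1) S1; have := m_prov n; rewrite -/C; lia.
- move=> /(@nd_deduction _ _ [:: C]) D; apply: nP; apply: nd_impI.
  apply: nd_cut (nd_iffl (HC _) (nd_andEr (nd_hyp0 _ _ _))) _.
  apply: nd_weak (D _ _) => [B|B ->|B] /=; [tauto|tauto|].
  by case=> // <-; apply: sentence_ex_relativise.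
- by apply: nd_iffr (nd_sub _ (HC _)) _; [left|apply: nd_ax; right].
Qed.

Lemma rho_I_le k n : k <= n -> rho (I k) <= rho (I n).
Proof.
elim: n => [|n IH]; first by rewrite leqn0 => /eqP ->.
rewrite leq_eqVlt => /orP[/eqP -> //|/IH].
by have := m_le_rho n; have := m_prov n; lia.
Qed.

(* The axioms of U for the false sentences Sent k with k < l are implied by   *)
(* the negations of their premises.                                           *)
Definition refute (l : nat) : theory := fun A => exists k,
  [/\ k < l, ~ true_sentence (Sent k) & A = Not (ex_relativise (I k) (Sent k))].

Lemma refute_sentence l A : refute l A -> sentence A.
Proof.
move=> [k [_ _ ->]]; have := sentence_ex_relativise (HI k) (HSent k).
by rewrite /sentence /= => ->.
Qed.

Lemma refute_true l A : refute l A -> true_sentence A.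
Proof.
move=> [k [_ nT ->]] H; apply: nT.
apply/(sat_relativise _ _ (HI k)).
have := @proves_S12_sound _ (fun=> 0) (@nd_ex_relativise _ _ [::] (HI k) (HSent k)).
by case=> _; apply.
Qed.

(** Only existence of the list matters, so the truth of each sentence is decided classically. *)
Lemma refute_finite l : finite_theory (refute l).
Proof.
elim: l => [|l [L HL]]; first by exists [::] => A; split=> // -[k []].
have HS A : refute l A -> refute l.+1 A.
  by move=> [k [kl nT ->]]; exists k; split=> //; apply: ltnW.
have HE A : refute l.+1 A -> refute l A \/ ~ true_sentence (Sent l) /\
    A = Not (ex_relativise (I l) (Sent l)).
  move=> [k [kl nT ->]]; move: kl; rewrite ltnS leq_eqVlt => /orP[/eqP Ek|kl].
    by right; rewrite -Ek.
  by left; exists k.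
case: (classic (true_sentence (Sent l))) => Hl.
  by exists L => A; rewrite -HL; split; [move/HE => [|[]]|apply: HS].
exists (Not (ex_relativise (I l) (Sent l)) :: L) => A /=; rewrite -HL; split.
  by move/HE => [|[_ ->]]; [right|left].
by case=> [<-|/HS //]; exists l.
Qed.

Definition stage (C : form) (l : nat) : theory := fun A => A = C \/ refute l A.

Lemma stage_mono C k l A : k <= l -> stage C k A -> stage C l A.
Proof.
move=> kl [->|[j [jk nT ->]]]; first by left.
by right; exists j; split=> //; apply: leq_trans kl.
Qed.

Lemma stage_finite C l : finite_theory (stage C l).
Proof.
have [L HL] := refute_finite l; exists (C :: L) => A.
by rewrite /stage HL /=; split=> -[]; by [left|right].
Qed.

(** The refutations up to n are true, so their conjunction can serve as the side condition of
    [diagonal]. *)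
Lemma stage_base n : exists S,
  [/\ sigma1_sentence S, ~ true_sentence S, rho S <= rho prov + 1
    & consistent (theory_add S12 (stage (ex_relativise (I n) S) n.+1))].
Proof.
have [L HL] := refute_finite n.+1.
pose Phi := foldr And (Not Bot) L.
have [sPhi tPhi] : sentence Phi /\ true_sentence Phi.
  have : forall A, List.In A L -> sentence A /\ true_sentence A.
    by move=> A /HL H; split; [apply: refute_sentence H|apply: refute_true H].
  rewrite /Phi; elim: (L) => [_|A L' IH HL']; first by split.
  have [sA tA] := HL' A (or_introl erefl).
  have [B HB|sL tL] := IH; first by apply: HL'; right.
  by split; [rewrite /sentence /= sA sL|split].
have [S [SS nS rS nP]] := diagonal Hprov sPhi tPhi (HI n).
exists S; split=> // D; apply: nP; apply: nd_impI.
have sC := sentence_ex_relativise (HI n) SS.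
set C := ex_relativise (I n) S in D sC.
apply: (@nd_cut_list _ (C :: L)) => [B [<-|HB]|].
- exact: nd_iffl (nd_ex_relativise _ (HI n) SS) (nd_andEr (nd_hyp0 _ _ _)).
- exact: nd_conj HB (nd_andEl (nd_hyp0 _ _ _)).
apply: (@nd_weak _ ((C :: L) ++ [::])).
  by move=> B; rewrite cats0 => HB; apply: (List.in_or_app (C :: L)); left.
apply: nd_deduction D => [B [->|/HL HB]|B [<-|/HL/refute_sentence]] //.
- by left.
- by right.
Qed.

(** Every axiom added so far has complexity at most [m l], as [rho (I k)] is nondecreasing in k. So
    [I l.+1] is sound for this theory, which cannot prove a false sentence there. *)
Lemma stage_step n S l : sigma1_sentence S -> rho S <= rho prov + 1 -> n <= l ->
  consistent (theory_add S12 (stage (ex_relativise (I n) S) l.+1)) ->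
  consistent (theory_add S12 (stage (ex_relativise (I n) S) l.+2)).
Proof.
move=> SS rS nl; set C := ex_relativise _ S => Hcon.
have sC : sentence C by apply: sentence_ex_relativise.
have Hsound : sigma1_sound_on (I l.+1) (theory_add S12 (stage C l.+1)).
  apply: (@finite_sound l _ C) => //; first exact: stage_finite; first by left.
  move=> A [->|HA].
    split=> //; have := rho_ex_relativise (I n) (proj1 SS).
    by have := rho_I_le nl; have := m_prov l; rewrite -/C; lia.
  split; first exact: refute_sentence HA.
  case: HA => k [kl _ ->]; rewrite /rho /= maxn0.
  have := rho_ex_relativise (I k) (proj1 (HSent k)); rewrite /rho.
  have := m_Sent (kl : k <= l); have := rho_I_le (kl : k <= l); rewrite /rho.
  by have := m_prov l; rewrite /rho; lia.
(* If the next sentence is true, no axiom is added; if it is false, inconsistency would make the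
   previous stage prove it on its cut. *)
case: (classic (true_sentence (Sent l.+1))) => [Hl|nl1] D.
  apply: Hcon; apply: nd_sub D => A [SA|[->|[k [kl nT ->]]]]; first by left.
    by right; left.
  right; right; exists k; split=> //; move: kl; rewrite ltnS leq_eqVlt.
  by case/orP=> // /eqP Ek; case: nT; rewrite Ek.
apply: (nl1); apply: (Hsound _ (HSent _)).
apply: nd_iffr (nd_sub _ (nd_ex_relativise _ (HI _) (HSent _))) _; first by left.
apply: nd_raa; set X := Not _.
apply: (@nd_deduction _ (eq X) [:: X] [::]) => [B <-|B [<-|[]]|]; first by left.
  by apply: (@refute_sentence l.+2); exists l.+1.
apply: nd_sub D => A [SA|[->|[k [kl nT ->]]]]; first by left; left.
  by left; right; left.
move: kl; rewrite ltnS leq_eqVlt => /orP[/eqP ->|kl]; first by right.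
by left; right; right; exists k.
Qed.

Lemma stage_consistent n : exists S,
  [/\ sigma1_sentence S, ~ true_sentence S
    & consistent (fun A => exists l, theory_add S12 (stage (ex_relativise (I n) S) l) A)].
Proof.
have [S [SS nS rS Hbase]] := stage_base n; exists S; split=> // /nd_compact.
case=> [k l A kl [SA|HA]|l D]; [by left|by right; apply: stage_mono HA|].
have Hcon : forall j, consistent (theory_add S12 (stage (ex_relativise (I n) S) (j + n).+1)).
  elim=> [|j IH] //; exact: stage_step SS rS (leq_addl _ _) IH.
apply: (Hcon l); apply: nd_sub D => A [SA|HA]; first by left.
by right; apply: stage_mono HA; lia.
Qed.

End Construction.

(** * Comparing cuts, and the contradiction in the limit theory *)

Lemma subcut_refl I : subcut I I.
Proof. by apply: nd_allI; apply: nd_impI; apply: nd_hyp0. Qed.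

Lemma subcut_trans I J K : subcut I J -> subcut J K -> fv I <= 1 -> fv J <= 1 -> fv K <= 1 ->
  subcut I K.
Proof.
move=> HIJ HJK fI fJ fK; apply: nd_allI; apply: nd_impI.
rewrite -(inst_var0 fK); apply: subcut_nd HJK _; apply: subcut_nd HIJ _.
by rewrite (inst_var0 fI); apply: nd_hyp0.
Qed.

Theorem theorem9p5
  (axs : seq form) (Haxs : finite_axiomatisation S12 axs)
  (prov : form) (Hprov : provability_predicate prov)
  (Sent : nat -> form) (HSent : enumerates_sigma1 Sent)
  (J : nat -> form) (HJeff : effective J) (HJ : descending_cofinal_cuts J)
  (I : nat -> form) (m : nat -> nat)
  (HI0 : I 0 = J 0)
  (Hm : forall n,
     m n = maxn (rho_axioms axs)
             (maxn (rho prov + rho (I n) + 1) (\max_(i < n.+1) rho (Sent i))))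
  (HIcut : forall n, cut (I n.+1))
  (HIsub : forall n, subcut (I n.+1) (J n.+1))
  (HIsound : forall n (T : theory),
     extension_of_complexity (m n) T -> re_theory T -> consistent T ->
     sigma1_sound_on (I n.+1) T) :
  ~ exists Istar : form,
      cut Istar /\
      forall A K : form, sigma1_sentence A -> cut K ->
        proves (U Sent I J) (Imp (relativise Istar A) (relativise K A)).
Proof.
case: HSent HJ => HS1 Hall [Jcut _ Jcof] [Istar [Hstar HU]].
have HI n : cut (I n) by case: n => [|n] //; rewrite HI0.
have HIJ n : subcut (I n) (J n).
  by case: n => [|n] //; rewrite HI0; apply: subcut_refl.
have fvcut K : cut K -> fv K <= 1 by case.
have [n Hn] := Jcof _ Hstar.
have Hsub : subcut (I n) Istar by apply: subcut_trans (HIJ n) Hn _ _ _; apply: fvcut.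
have [S [SS nS]] := stage_consistent Haxs Hprov HS1 Hm HI HIsound n.
set T := (fun A => _); case.
have [i Hi] := Hall S SS.
have S12T B : S12 B -> T B by exists 0; left.
have Hnd k G : nd T G (Iff (relativise (I k) (Sent k)) (ex_relativise (I k) (Sent k))).
  exact/(nd_sub S12T)/nd_ex_relativise.
have Hneg k : ~ true_sentence (Sent k) -> proves T (Not (ex_relativise (I k) (Sent k))).
  by move=> nk; apply: nd_ax; exists k.+1; right; right; exists k.
have UT B : U Sent I J B -> proves T B.
  case=> [/S12T|[k [j ->]]]; first exact: nd_ax.
  apply: nd_impI; case: (classic (true_sentence (Sent k))) => Hk.
    by apply/nd_wk/(nd_sub S12T)/sigma1_cut_complete.
  apply: nd_absurd (nd_wk _ (Hneg k Hk)) _.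
  exact: nd_iffl (Hnd _ _) (nd_hyp0 _ _ _).
apply: nd_impE (Hneg i _) _; first by rewrite Hi.
apply: nd_iffl (Hnd i _) _; rewrite Hi.
(* The uniformity of [Istar] is applied to the very cut [I i] on which the limit refutes S = S_i. *)
apply: nd_impE (nd_theory UT (HU S (I i) SS (HI i))) _.
have HD : nd S12 [:: ex_relativise (I n) S] (relativise Istar S).
  apply: (@relativise_mono (I n)) => //.
  exact: nd_iffr (nd_ex_relativise _ (HI n) SS) (nd_hyp0 _ _ _).
apply: nd_cut (nd_sub S12T HD).
by apply: nd_ax; exists 0; right; left.
Qed.
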